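(* Let $n\in\mathbb N$, $q>1$ and $p\in(\tfrac23 q+1,\,q+\tfrac23)$. Then, in any knot class, there is a minimizer of $\mathrm{intM}^{(p,q)}$ among all injective, regular curves $\gamma\in C^1(\mathbb R/\mathbb Z,\mathbb R^n)$ belonging to that knot class.
   Context: For $a,b\in\mathbb R^n$ put $|a\wedge b|=\sqrt{|a|^2|b|^2-\langle a,b\rangle^2}$. For an absolutely continuous curve $\gamma:\mathbb R/\mathbb Z\to\mathbb R^n$ and $p,q>0$ the generalized integral Menger curvature is $$\mathrm{intM}^{(p,q)}(\gamma)=\iiint_{(\mathbb R/\mathbb Z)^3}\frac{|(y-x)\wedge(z-x)|^q}{(|y-z||y-x||z-x|)^p}\,|\gamma'(u_1)||\gamma'(u_2)||\gamma'(u_3)|\,du_1\,du_2\,du_3,$$ with $x=\gamma(u_1)$, $y=\gamma(u_2)$, $z=\gamma(u_3)$. A curve is regular if there is $c>0$ with $|\gamma'|\ge c$ a.e. A knot class is an ambient isotopy class of injective regular closed $C^1$ curves in $\mathbb R^n$.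
   Formalization: The minimizer is sought among curves of prescribed length L, for every L > 0, in the knot class; over all lengths the energy tends to 0 under dilation because 2q-3p+3 < 0, so no minimizer exists. *)

(* Defs.v *)
From HB Require Import structures.
From mathcomp Require Import all_boot all_order all_algebra.
From mathcomp Require Import all_classical all_reals all_analysis.

Set Implicit Arguments.
Unset Strict Implicit.
Unset Printing Implicit Defensive.

Import Order.TTheory GRing.Theory Num.Theory.
Import numFieldNormedType.Exports.

Local Open Scope classical_set_scope.
Local Open Scope ring_scope.

(* The library norm of ['rV[R]_n] is the sup norm (it induces the same
   topology), hence the explicit Euclidean structure. *)
Definition dotr (R : realType) (n : nat) (a b : 'rV[R]_n) : R :=
  \sum_(i < n) a ord0 i * b ord0 i.

Definition enorm (R : realType) (n : nat) (a : 'rV[R]_n) : R :=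
  Num.sqrt (dotr a a).

Definition wedge (R : realType) (n : nat) (a b : 'rV[R]_n) : R :=
  Num.sqrt (enorm a ^+ 2 * enorm b ^+ 2 - dotr a b ^+ 2).

(* A curve on R/Z is a 1-periodic map on R; integrals over R/Z are integrals
   over the fundamental domain [0, 1]. *)
Definition closed_curve (R : realType) (n : nat) (g : R -> 'rV[R]_n) : Prop :=
  forall t : R, g (t + 1) = g t.

Definition curve_C1 (R : realType) (n : nat) (g : R -> 'rV[R]_n) : Prop :=
  (forall t : R, derivable g t 1) /\ continuous (derive1 g).

Definition curve_injective (R : realType) (n : nat) (g : R -> 'rV[R]_n) :
    Prop :=
  {in `[0, 1[ &, injective g}.

Definition curve_regular (R : realType) (n : nat) (g : R -> 'rV[R]_n) : Prop :=
  exists2 c : R, 0 < c &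
    {ae (@lebesgue_measure R), forall t, c <= enorm (derive1 g t)}.

Definition knot_curve (R : realType) (n : nat) (g : R -> 'rV[R]_n) : Prop :=
  [/\ closed_curve g, curve_C1 g, curve_injective g & curve_regular g].

(* The quotient takes the value 0 when two of the three points coincide
   (x / 0 = 0 in the library); the numerator vanishes there too, and for an
   injective curve these parameters form a null set. *)
Definition intM_density (R : realType) (n : nat) (p q : R)
    (g : R -> 'rV[R]_n) (u1 u2 u3 : R) : R :=
  let x := g u1 in let y := g u2 in let z := g u3 in
  wedge (y - x) (z - x) `^ q
    / (enorm (y - z) * enorm (y - x) * enorm (z - x)) `^ p
  * (enorm (derive1 g u1) * enorm (derive1 g u2) * enorm (derive1 g u3)).

Definition intM (R : realType) (n : nat) (p q : R) (g : R -> 'rV[R]_n) :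
    \bar R :=
  (\int[(@lebesgue_measure R) \x (@lebesgue_measure R)
          \x (@lebesgue_measure R)]_(u in (`[0%R, 1%R] `*` `[0%R, 1%R]) `*` `[0%R, 1%R])
     (intM_density p q g u.1.1 u.1.2 u.2)%:E)%E.

Definition curve_length (R : realType) (n : nat) (g : R -> 'rV[R]_n) :
    \bar R :=
  (\int[@lebesgue_measure R]_(t in `[0%R, 1%R]) (enorm (derive1 g t))%:E)%E.

Definition homeomorphism (T U : topologicalType) (f : T -> U) : Prop :=
  continuous f /\
  exists2 f' : U -> T, continuous f' & cancel f f' /\ cancel f' f.

Definition isotopy (R : realType) (T : topologicalType) (H : R -> T -> T) :
    Prop :=
  [/\ {within `[0, 1] `*` [set: T], continuous (fun z : R * T => H z.1 z.2)},
      forall t : R, t \in `[0, 1] -> homeomorphism (H t)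
    & H 0 = id].

(* Knots are compared through their images, so a knot class does not depend on
   parametrization or orientation. *)
Definition ambient_isotopic (R : realType) (n : nat)
    (g h : R -> 'rV[R]_n) : Prop :=
  exists2 H : R -> 'rV[R]_n -> 'rV[R]_n,
    isotopy H & H 1 @` range g = range h.

Definition knot_class (R : realType) (n : nat) (K : set (R -> 'rV[R]_n)) :
    Prop :=
  exists2 g : R -> 'rV[R]_n, knot_curve g &
    K = [set h | knot_curve h /\ ambient_isotopic g h].

Definition minimizer (R : realType) (T : Type) (E : T -> \bar R) (A : set T)
    (x : T) : Prop :=
  A x /\ forall y, A y -> (E x <= E y)%E.

(* intM p q (l *: g) = l `^ (2 q - 3 p + 3) * intM p q g for l > 0, and knot
   classes are invariant under dilation. For p > 2/3 q + 1 the exponent is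
   negative, so without a normalization of length the infimum over a whole knot
   class containing a curve of finite energy is 0; it is never attained, since
   no closed injective C^1 curve lies on a line. Minimization within a knot
   class is therefore at prescribed length. *)
Definition of_length (R : realType) (n : nat) (L : R) :
    set (R -> 'rV[R]_n) :=
  [set g | curve_length g = L%:E].

(* Main.v *)
(** Write [e = (3p+3)/(q+3)]; the hypothesis on [p] says [e > 2].  If three
    points of a curve of constant speed lie within distance [r] of each other
    and span a parallelogram of area [W], then moving the three parameters by
    a small multiple of [W / r] changes [W] at most by a factor 2, so a bound
    on the energy over this box of parameters yields [W <= C r^e] with [C]
    depending on the energy only.  Comparing the directions of the chords of
    lengths [h, h/2, h/4, ...] at a point, this flatness gives a Hölder bound
    for the unit tangent on every scale on which the tangent oscillates
    little; the bound is self-improving, hence holds below a scale depending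
    on the energy only.  At a pair of closest points that are far apart along
    the curve the secant is orthogonal to a tangent, which contradicts flatness
    if the two points are too close.  So curves of bounded energy and constant
    speed are uniformly [C^{1,e-2}] and uniformly bi-Lipschitz.

    A minimizing sequence, reparametrized by constant speed and translated,
    therefore has a [C^1] limit along a subsequence.  The limit is embedded,
    and it is in the knot class: if [x] is bi-Lipschitz and [g - x] is small in
    [C^1], the displacement [x u |-> g u - x u] extends to a map [V] of the
    space with Lipschitz constant below 1, and [id + t V] is an ambient
    isotopy.  Fatou's lemma gives lower semicontinuity of the energy. *)

Require Import Defs.
From HB Require Import structures.
From mathcomp Require Import all_boot all_order all_algebra.
From mathcomp Require Import all_classical all_reals all_analysis.
From mathcomp Require Import measurable_realfun ring lra.

Set Implicit Arguments.
Unset Strict Implicit.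
Unset Printing Implicit Defensive.

Import Order.TTheory GRing.Theory Num.Theory.
Import numFieldNormedType.Exports.

Local Open Scope classical_set_scope.
Local Open Scope ring_scope.

(** * Euclidean geometry *)

Section Euclidean.
Context {R : realType} {n : nat}.
Implicit Types (a b c : 'rV[R]_n) (k : R).

Lemma dotrC a b : dotr a b = dotr b a.
Proof. by apply: eq_bigr => i _; rewrite mulrC. Qed.

Lemma dotrDl a b c : dotr (a + b) c = dotr a c + dotr b c.
Proof.
by rewrite /dotr -big_split; apply: eq_bigr => i _; rewrite mxE mulrDl.
Qed.

Lemma dotrZl k a b : dotr (k *: a) b = k * dotr a b.
Proof.
by rewrite /dotr mulr_sumr; apply: eq_bigr => i _; rewrite mxE mulrA.
Qed.

Lemma dotrDr a b c : dotr a (b + c) = dotr a b + dotr a c.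
Proof. by rewrite dotrC dotrDl !(dotrC a). Qed.

Lemma dotrZr k a b : dotr a (k *: b) = k * dotr a b.
Proof. by rewrite dotrC dotrZl dotrC. Qed.

Lemma dotrNl a b : dotr (- a) b = - dotr a b.
Proof. by rewrite -scaleN1r dotrZl mulN1r. Qed.

Lemma dotrNr a b : dotr a (- b) = - dotr a b.
Proof. by rewrite dotrC dotrNl dotrC. Qed.

Lemma dotrBl a b c : dotr (a - b) c = dotr a c - dotr b c.
Proof. by rewrite dotrDl dotrNl. Qed.

Definition dotrE := (dotrDl, dotrDr, dotrNl, dotrNr, dotrZl, dotrZr).

Lemma dotr_ge0 a : 0 <= dotr a a.
Proof. by apply: sumr_ge0 => i _; rewrite -expr2 sqr_ge0. Qed.

Lemma sqr_enorm a : enorm a ^+ 2 = dotr a a.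
Proof. by rewrite sqr_sqrtr ?dotr_ge0. Qed.

Lemma enorm_ge0 a : 0 <= enorm a.
Proof. exact: sqrtr_ge0. Qed.

Lemma normr_coord_enorm a i : `|a ord0 i| <= enorm a.
Proof.
rewrite -sqrtr_sqr ler_sqrt ?dotr_ge0// /dotr (bigD1 i)//= -expr2.
by rewrite lerDl sumr_ge0// => j _; rewrite -expr2 sqr_ge0.
Qed.

Lemma enorm_eq0 a : (enorm a == 0) = (a == 0).
Proof.
apply/eqP/eqP => [a0|->]; last first.
  by rewrite /enorm /dotr big1 ?sqrtr0// => i _; rewrite mxE mul0r.
apply/rowP => i; rewrite mxE; apply/eqP; rewrite -normr_le0 -a0.
exact: normr_coord_enorm.
Qed.

Lemma enorm_gt0 a : (0 < enorm a) = (a != 0).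
Proof. by rewrite lt_def enorm_ge0 andbT enorm_eq0. Qed.

Lemma enorm0 : enorm (0 : 'rV[R]_n) = 0.
Proof. by apply/eqP; rewrite enorm_eq0. Qed.

Lemma enormZ k a : enorm (k *: a) = `|k| * enorm a.
Proof.
rewrite /enorm dotrZl dotrZr mulrA -expr2 sqrtrM ?sqr_ge0//.
by rewrite sqrtr_sqr.
Qed.

Lemma enormN a : enorm (- a) = enorm a.
Proof. by rewrite -scaleN1r enormZ normrN1 mul1r. Qed.

Lemma enormBC a b : enorm (a - b) = enorm (b - a).
Proof. by rewrite -opprB enormN. Qed.

(** Expanding the squared norm of [dotr b b *: a - dotr a b *: b], which is nonnegative, gives
    [dotr b b] times the difference of the two sides. *)
Lemma sqr_dotr_le a b : dotr a b ^+ 2 <= enorm a ^+ 2 * enorm b ^+ 2.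
Proof.
have [->|b0] := eqVneq b 0.
  by rewrite enorm0 expr0n/= mulr0 -(scale0r 0) dotrZr mul0r expr0n.
have bb : 0 < dotr b b by rewrite -sqr_enorm exprn_gt0// enorm_gt0.
have := dotr_ge0 (dotr b b *: a - dotr a b *: b).
rewrite !dotrE (dotrC b a) !sqr_enorm => h.
rewrite -subr_ge0 -(pmulr_rge0 _ bb); apply: le_trans h _.
by rewrite le_eqVlt; apply/orP; left; apply/eqP; ring.
Qed.

Lemma normr_dotr_le a b : `|dotr a b| <= enorm a * enorm b.
Proof.
rewrite -(@ler_pXn2r _ 2) ?nnegrE ?mulr_ge0 ?enorm_ge0//.
by rewrite real_normK ?num_real// exprMn sqr_dotr_le.
Qed.

Lemma dotr_le a b : dotr a b <= enorm a * enorm b.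
Proof. exact: le_trans (ler_norm _) (normr_dotr_le a b). Qed.

Lemma dotr_geN a b : - (enorm a * enorm b) <= dotr a b.
Proof. by have := normr_dotr_le a b; rewrite ler_norml => /andP[]. Qed.

Lemma sqr_enormD a b :
  enorm (a + b) ^+ 2 = enorm a ^+ 2 + 2 * dotr a b + enorm b ^+ 2.
Proof. rewrite !sqr_enorm !dotrE (dotrC b a); ring. Qed.

Lemma sqr_enormB a b :
  enorm (a - b) ^+ 2 = enorm a ^+ 2 - 2 * dotr a b + enorm b ^+ 2.
Proof. rewrite !sqr_enorm !dotrE (dotrC b a); ring. Qed.

Lemma enormD a b : enorm (a + b) <= enorm a + enorm b.
Proof.
rewrite -(@ler_pXn2r _ 2) ?nnegrE ?addr_ge0 ?enorm_ge0// sqr_enormD.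
have := dotr_le a b; nra.
Qed.

Lemma enormB a b : enorm (a - b) <= enorm a + enorm b.
Proof. by rewrite -(enormN b) enormD. Qed.

Lemma enorm_dist_le a b : enorm a - enorm b <= enorm (a - b).
Proof. by rewrite lerBlDr -{1}(subrK b a) enormD. Qed.

Lemma enormB_trans c a b : enorm (a - b) <= enorm (a - c) + enorm (c - b).
Proof. by rewrite -{1}(subrK c a) -addrA enormD. Qed.

Lemma enorm_le_sum a : enorm a <= \sum_(i < n) `|a ord0 i|.
Proof.
rewrite -(@ler_pXn2r _ 2) ?nnegrE ?enorm_ge0 ?sumr_ge0// sqr_enorm expr2.
rewrite /dotr mulr_suml; apply: ler_sum => i _.
rewrite -[leLHS]ger0_norm -?expr2 ?sqr_ge0// normrX expr2 ler_wpM2l//.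
by rewrite (bigD1 i)//= lerDl sumr_ge0.
Qed.

Lemma normr_le_enorm a : `|a| <= enorm a.
Proof.
rewrite [leLHS]/Num.Def.normr/= mx_normrE; apply: bigmax_le; first exact: enorm_ge0.
by move=> [i j] _ /=; rewrite ord1 normr_coord_enorm.
Qed.

Lemma normr_coord_le a i : `|a ord0 i| <= `|a|.
Proof.
rewrite [leRHS]/Num.Def.normr/= mx_normrE.
exact: (@le_bigmax_cond _ _ _ _ (ord0, i) predT (fun ij => `|a ij.1 ij.2|)).
Qed.

Lemma enorm_le_normr a : enorm a <= n%:R * `|a|.
Proof.
apply: le_trans (enorm_le_sum a) _; rewrite mulr_natl -[X in _ *+ X]card_ord.
by rewrite -sumr_const; apply: ler_sum => i _; exact: normr_coord_le.
Qed.

(** * Areas of parallelograms *)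

Lemma wedgeC a b : wedge a b = wedge b a.
Proof. by rewrite /wedge mulrC dotrC. Qed.

Lemma wedge_ge0 a b : 0 <= wedge a b.
Proof. exact: sqrtr_ge0. Qed.

Lemma sqr_wedge a b :
  wedge a b ^+ 2 = enorm a ^+ 2 * enorm b ^+ 2 - dotr a b ^+ 2.
Proof. by rewrite sqr_sqrtr// subr_ge0 sqr_dotr_le. Qed.

Lemma wedge_le a b : wedge a b <= enorm a * enorm b.
Proof.
rewrite -(@ler_pXn2r _ 2) ?nnegrE ?mulr_ge0 ?enorm_ge0 ?wedge_ge0//.
by rewrite sqr_wedge exprMn gerBl sqr_ge0.
Qed.

(* [a ∧ b] is the norm of a vector depending linearly on [b]; this gives the
   triangle inequality. *)
Lemma wedgeE a b :
  wedge a b = enorm (enorm a *: b - (dotr a b / enorm a) *: a).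
Proof.
have [->|a0] := eqVneq a 0.
  rewrite enorm0 scale0r sub0r scaler0 oppr0 enorm0 /wedge enorm0.
  by rewrite -(scale0r (0 : 'rV[R]_n)) dotrZl !mul0r expr0n/= mul0r subr0 sqrtr0.
apply/eqP; rewrite -(@eqrXn2 _ 2) ?wedge_ge0 ?enorm_ge0// sqr_wedge.
have e0 : enorm a != 0 by rewrite enorm_eq0.
rewrite sqr_enormB !enormZ !dotrE !exprMn !real_normK ?num_real// (dotrC b a).
apply/eqP; field.
exact: e0.
Qed.

Lemma wedgeDr a b c : wedge a (b + c) <= wedge a b + wedge a c.
Proof.
rewrite !wedgeE; apply: le_trans (enormD _ _).
rewrite dotrDr scalerDr mulrDl scalerDl opprD addrACA; exact: lexx.
Qed.

Lemma wedgeDl a b c : wedge (a + b) c <= wedge a c + wedge b c.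
Proof. by rewrite !(wedgeC _ c) wedgeDr. Qed.

Lemma wedgeZl k a b : wedge (k *: a) b = `|k| * wedge a b.
Proof.
rewrite /wedge enormZ dotrZl !exprMn real_normK ?num_real// -mulrA -mulrBr.
by rewrite sqrtrM ?sqr_ge0// sqrtr_sqr.
Qed.

Lemma wedgeZr k a b : wedge a (k *: b) = `|k| * wedge a b.
Proof. by rewrite wedgeC wedgeZl wedgeC. Qed.

(** The vectors are replaced one at a time: the first replacement costs [d * r], the second
    [(r + d) * d]. *)
Lemma wedge_perturb (r d : R) a b a' b' :
  enorm a <= r -> enorm b <= r -> enorm (a - a') <= d -> enorm (b - b') <= d ->
  wedge a b <= wedge a' b' + d * (2 * r + d).
Proof.
move=> ar br aa bb.
have h1 : wedge a b <= wedge a' b + wedge (a - a') b.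
  by rewrite -{1}(subrK a' a) addrC wedgeDl.
have h2 : wedge a' b <= wedge a' b' + wedge a' (b - b').
  by rewrite -{1}(subrK b' b) addrC wedgeDr.
have h3 := wedge_le (a - a') b.
have h4 := wedge_le a' (b - b').
have h5 : enorm a' <= r + d.
  have := enorm_dist_le a' a; rewrite enormBC => h.
  lra.
have := enorm_ge0 (a - a'); have := enorm_ge0 (b - b').
have := enorm_ge0 b; have := enorm_ge0 a' => ? ? ? ?.
nra.
Qed.

Lemma enorm_normalize a : a != 0 -> enorm ((enorm a)^-1 *: a) = 1.
Proof.
rewrite -enorm_eq0 => a0.
by rewrite enormZ ger0_norm ?invr_ge0 ?enorm_ge0// mulVf.
Qed.

(* For unit vectors at an acute angle, [|a - b|^2 = 2 - 2 cos <= 2 sin^2]. *)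
Lemma normalize_dist_le a b : a != 0 -> b != 0 -> 0 <= dotr a b ->
  enorm ((enorm a)^-1 *: a - (enorm b)^-1 *: b) <=
  2 * wedge a b / (enorm a * enorm b).
Proof.
move=> a0 b0 ab0.
have ea : 0 < enorm a by rewrite enorm_gt0.
have eb : 0 < enorm b by rewrite enorm_gt0.
have e0 : 0 < enorm a * enorm b by rewrite mulr_gt0.
rewrite -(@ler_pXn2r _ 2) ?nnegrE ?enorm_ge0//; last first.
  by apply: divr_ge0; [rewrite mulr_ge0// wedge_ge0|exact: ltW].
set c := dotr a b / (enorm a * enorm b).
have c0 : 0 <= c by rewrite divr_ge0// ltW.
have c1 : c <= 1 by rewrite ler_pdivrMr// mul1r dotr_le.
have -> : (2 * wedge a b / (enorm a * enorm b)) ^+ 2 = 4 * (1 - c ^+ 2).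
  rewrite !exprMn sqr_wedge /c; field.
  by rewrite (gt_eqF ea) (gt_eqF eb).
have -> : enorm ((enorm a)^-1 *: a - (enorm b)^-1 *: b) ^+ 2 = 2 - 2 * c.
  rewrite sqr_enormB !enorm_normalize// !dotrE /c invfM; ring.
by nra.
Qed.

End Euclidean.

(** * Calculus of closed curves *)

Lemma lipschitz_cts (R : realType) (V W : normedModType R) (f : V -> W) (k : R) :
  (forall x y, `|f x - f y| <= k * `|x - y|) -> continuous f.
Proof.
move=> fk x; apply/cvgrPdist_lt => e e0.
have k1 : 0 < `|k| + 1 by rewrite ltr_wpDl.
have d0 : 0 < e / (`|k| + 1) by rewrite divr_gt0.
near=> y; apply: le_lt_trans (fk x y) _.
apply: (@le_lt_trans _ _ ((`|k| + 1) * `|x - y|)).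
  by rewrite ler_wpM2r// (le_trans (ler_norm k))// lerDl.
by rewrite mulrC -ltr_pdivlMr.
Unshelve. all: by end_near. Qed.

Section Euclidean_continuity.
Context {R : realType} {n : nat}.
Implicit Types (a b e : 'rV[R]_n).

Lemma dotr_continuous e : continuous (fun a => dotr a e).
Proof.
apply: (@lipschitz_cts _ _ _ _ (n%:R * enorm e)) => a b.
rewrite -dotrBl (le_trans (normr_dotr_le _ _))// mulrAC.
by rewrite ler_wpM2r ?enorm_ge0// enorm_le_normr.
Qed.

Lemma enorm_continuous : continuous (@enorm R n).
Proof.
apply: (@lipschitz_cts _ _ _ _ n%:R) => a b.
apply: le_trans (enorm_le_normr _); rewrite ler_norml enorm_dist_le andbT.
by rewrite lerNl opprB enormBC enorm_dist_le.
Qed.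

(** Lets limits be estimated in the Euclidean norm although the topology comes from the sup norm;
    the two differ by at most the factor [n]. *)
Lemma cvg_enormP (T : Type) (F : set_system T) (FF : Filter F)
    (f : T -> 'rV[R]_n) a :
  (f x @[x --> F] --> a) <->
  (forall e : R, 0 < e -> \forall x \near F, enorm (f x - a) <= e).
Proof.
split=> [fa e e0|fa].
  have d0 : 0 < e / (n%:R + 1) by rewrite divr_gt0// ltr_wpDl.
  move/cvgrPdist_lt : fa => /(_ _ d0); apply: filterS => x fx.
  apply: le_trans (enorm_le_normr _) _.
  rewrite distrC in fx; apply: (@le_trans _ _ ((n%:R + 1) * `|f x - a|)).
    by rewrite ler_wpM2r// lerDl.
  by rewrite mulrC -ler_pdivlMr ?ltr_wpDl// ltW.
apply/cvgrPdist_le => e e0; apply: filterS (fa e e0) => x; apply: le_trans.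
by rewrite distrC normr_le_enorm.
Qed.

End Euclidean_continuity.

Section periodic.
Context {R : realType} {T : Type}.
Variables (f : R -> T) (fp : forall t, f (t + 1) = f t).

Lemma periodic_int (t : R) (k : int) : f (t + k%:~R) = f t.
Proof.
have pos m u : f (u + m%:R) = f u.
  by elim: m u => [|m IH] u; rewrite ?addr0// -natr1 addrA fp IH.
case: k => m; first exact: pos.
by rewrite NegzE mulrNz -(pos m.+1 (t - _)) subrK.
Qed.

End periodic.

Lemma fract_itv (R : realType) (t : R) :
  exists k : int, 0 <= t - k%:~R < 1.
Proof.
exists (Num.floor t); have /andP[h1 h2] := floor_itv t.
by rewrite subr_ge0 h1/= ltrBlDr addrC (lt_le_trans h2)// intrD.
Qed.

(** * Mean value inequalities for curves *)

Section curve_calculus.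
Context {R : realType} {n : nat}.
Variable g : R -> 'rV[R]_n.
Hypothesis dg : forall t : R, derivable g t 1.

Lemma is_derive_dotr (e : 'rV[R]_n) (t : R) :
  is_derive t 1 (fun u => dotr (g u) e) (dotr (derive1 g t) e).
Proof.
have h : h^-1 *: (dotr (g (h *: 1 + t)) e - dotr (g t) e) @[h --> 0^'] -->
    dotr (derive1 g t) e.
  have := @dg t; rewrite /derivable => /cvg_ex[l /= gl].
  have -> : derive1 g t = l by rewrite derive1E; exact/cvg_lim.
  have := @cvg_comp _ _ _ _ (fun a => dotr a e) _ _ _ gl (@dotr_continuous R n e l).
  apply: cvg_trans; apply: near_eq_cvg; near=> x.
  by rewrite /= dotrZl dotrBl.
split; last exact/cvg_lim.
by apply/cvg_ex; exists (dotr (derive1 g t) e).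
Unshelve. all: by end_near. Qed.

Lemma derivable_curve_continuous : continuous g.
Proof.
by move=> t; apply: differentiable_continuous; apply/derivable1_diffP.
Qed.

(** The mean value theorem fails for vector-valued maps, so it is applied to the component along a
    fixed [e], on which [xi] depends. Bounding [|xi - s|] covers both orders of [s] and [t]. *)
Lemma curve_mvt (e : 'rV[R]_n) (s t : R) : exists2 xi, `|xi - s| <= `|t - s| &
  dotr (g t - g s) e = (t - s) * dotr (derive1 g xi) e.
Proof.
wlog st : s t / s <= t.
  move=> H; have [|/ltW ts] := leP s t; first exact: H.
  have [xi h1 h2] := MVT_segment ts (fun x _ => is_derive_dotr e x)
    (continuous_subspaceT (fun x => continuous_comp (@derivable_curve_continuous x)
      (@dotr_continuous R n e _))).
  exists xi; last by rewrite -opprB dotrNl dotrBl h2 mulrC -mulNr opprB.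
  move: h1; rewrite in_itv/= => /andP[h1 h3].
  by rewrite !ler0_norm ?subr_le0// !opprB lerB.
have [xi h1 h2] := MVT_segment st (fun x _ => is_derive_dotr e x)
    (continuous_subspaceT (fun x => continuous_comp (@derivable_curve_continuous x)
      (@dotr_continuous R n e _))).
exists xi; last by rewrite dotrBl h2 mulrC.
move: h1; rewrite in_itv/= => /andP[h1 h3].
by rewrite !ger0_norm ?subr_ge0// lerB.
Qed.

(** Testing [curve_mvt] against the error vector itself bounds its squared norm, and one factor
    cancels. *)
Lemma curve_mvt_le (v : 'rV[R]_n) (K s t : R) :
  (forall xi, `|xi - s| <= `|t - s| -> enorm (derive1 g xi - v) <= K) ->
  enorm (g t - g s - (t - s) *: v) <= K * `|t - s|.
Proof.
move=> hK; set a := g t - g s - (t - s) *: v.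
have [->|a0] := eqVneq a 0.
  rewrite enorm0 mulr_ge0//; apply: le_trans (hK s _); first exact: enorm_ge0.
  by rewrite subrr normr0.
have [xi h1 h2] := curve_mvt a s t.
have ea : 0 < enorm a by rewrite enorm_gt0.
have : enorm a ^+ 2 = (t - s) * dotr (derive1 g xi - v) a.
  by rewrite sqr_enorm {1}/a dotrBl h2 dotrZl -mulrBr -dotrBl.
move=> h; rewrite -(ler_pM2r ea) -expr2 h.
apply: le_trans (ler_norm _) _; rewrite normrM (mulrC K) -mulrA.
rewrite ler_wpM2l// (le_trans (normr_dotr_le _ _))//.
by rewrite ler_wpM2r ?enorm_ge0// hK.
Qed.

Lemma curve_lipschitz (L s t : R) : (forall u, enorm (derive1 g u) <= L) ->
  enorm (g t - g s) <= L * `|t - s|.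
Proof.
move=> hL; rewrite -[g t - g s]subr0 -(scaler0 _ (t - s)).
by apply: curve_mvt_le => xi _; rewrite subr0.
Qed.

End curve_calculus.

Section closed_curve_calculus.
Context {R : realType} {n : nat}.
Variable g : R -> 'rV[R]_n.
Hypothesis gp : closed_curve g.

Lemma derive1_periodic (t : R) : derive1 g (t + 1) = derive1 g t.
Proof.
by rewrite /derive1; under eq_fun do rewrite addrA !gp.
Qed.

(** Compactness gives one [d] for all [s] in [[0, 1]] and every [t]; shifting [s] and [t] by the
    same integer gives the rest. *)
Lemma derive1_unif_continuous : continuous (derive1 g) ->
  forall e : R, 0 < e -> exists2 d : R, 0 < d &
    forall s t : R, `|s - t| <= d -> enorm (derive1 g s - derive1 g t) <= e.
Proof.
move=> cg e e0.
have := @segment_compact R 0 1.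
move=> /compact_near_coveringP /(_ R (0^'+)
  (fun d s => forall t, `|s - t| <= d -> enorm (derive1 g s - derive1 g t) <= e)).
move=> /(_ _)[].
  move=> x _.
  have e20 : 0 < e / 2 by rewrite divr_gt0.
  have /cvg_enormP /(_ _ e20) := cg x.
  move=> /nbhs_ballP[r /= r0 hr].
  have r20 : 0 < r / 2 by rewrite divr_gt0.
  exists (ball x (r / 2), [set d | d < r / 2]).
    by split; [exact: nbhsx_ballx | exact: nbhs_right_lt].
  move=> [s d]/= [xs dr] t st.
  rewrite (splitr e) (le_trans (enormB_trans (derive1 g x) _ _))// lerD//.
    by apply: hr; apply: le_ball xs; rewrite ler_pdivrMr// ler_peMr ?ler1n// ltW.
  rewrite enormBC; apply: hr; rewrite /ball/= (splitr r).
  rewrite -(subrKA s) (le_lt_trans (ler_normD _ _))// ltrD// (le_lt_trans st)//.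
move=> d /= d0 hd; exists (d / 2); first by rewrite divr_gt0.
move=> s t st; have [k /andP[k0 k1]] := fract_itv s.
rewrite -(periodic_int (derive1_periodic) s (- k)).
rewrite -(periodic_int (derive1_periodic) t (- k)) rmorphN/=.
apply: (hd (d / 2)).
- rewrite /ball/= sub0r normrN gtr0_norm ?divr_gt0//.
  by rewrite ltr_pdivrMr// ltr_pMr// ltr1n.
- by rewrite divr_gt0.
- by rewrite /= in_itv/= k0 ltW.
- by rewrite opprD addrACA subrr addr0.
Qed.

End closed_curve_calculus.

(** * Flat curves are Hölder and bi-Lipschitz *)

(** By [wedge_le] every curve satisfies this with [C = 1] and [e = 2]; an exponent above 2 is what
    forces nearby points to be almost collinear. *)
Definition flat {R : realType} {n : nat} (C e : R) (g : R -> 'rV[R]_n) : Prop :=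
  forall u1 u2 u3 r : R, 0 < r ->
    enorm (g u2 - g u1) <= r -> enorm (g u3 - g u1) <= r ->
    enorm (g u2 - g u3) <= r ->
    wedge (g u2 - g u1) (g u3 - g u1) <= C * r `^ e.

Definition normalize {R : realType} {n : nat} (a : 'rV[R]_n) :=
  (enorm a)^-1 *: a.

(** The difference is split into a multiple of [a], of norm [||b| - |a|| / |b|], and
    [(a - b) / |b|]; each is at most [|a - b| / |b|]. For [a = 0] the left side is 1 and the bound
    is 2. *)
Lemma normalize_lipschitz (R : realType) (n : nat) (a b : 'rV[R]_n) : b != 0 ->
  enorm (normalize a - normalize b) <= 2 * enorm (a - b) / enorm b.
Proof.
move=> b0; have eb : 0 < enorm b by rewrite enorm_gt0.
have [->|a0] := eqVneq a 0.
  rewrite /normalize scaler0 !sub0r !enormN enorm_normalize// mulfK ?gt_eqF//.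
  by rewrite ler1n.
have ea : 0 < enorm a by rewrite enorm_gt0.
have -> : normalize a - normalize b =
    ((enorm b)^-1 * (enorm b - enorm a) / enorm a) *: a + (enorm b)^-1 *: (a - b).
  rewrite /normalize scalerBr addrA -scalerDl; congr (_ *: _ - _).
  by field; rewrite (gt_eqF ea) (gt_eqF eb).
apply: le_trans (enormD _ _) _; rewrite !enormZ !normrM !normfV.
rewrite (gtr0_norm ea) (gtr0_norm eb) divfK ?gt_eqF// -mulrDr mulrC ler_wpM2r ?invr_ge0 ?(ltW eb)//.
rewrite mulr_natl mulr2n lerD2r ler_norml lerNl opprB enorm_dist_le/=.
by rewrite enormBC enorm_dist_le.
Qed.

(** * Hölder continuity of the tangent *)

Section flat_curve.
Context {R : realType} {n : nat}.
Variables (C e L : R) (g : R -> 'rV[R]_n).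
Hypotheses (C0 : 0 < C) (e2 : 2 < e) (L0 : 0 < L).
Hypotheses (gp : closed_curve g) (gC1 : curve_C1 g).
Hypothesis gL : forall u, enorm (derive1 g u) = L.
Hypothesis gflat : flat C e g.

Let k := e - 2.
Let k0 : 0 < k. Proof. by rewrite subr_gt0. Qed.

Definition oscillation_le (K d : R) := forall s t, `|s - t| <= d ->
  enorm (derive1 g s - derive1 g t) <= K.

Let lipg s t : enorm (g t - g s) <= L * `|t - s|.
Proof. by apply: curve_lipschitz => [|u]; [exact: gC1.1|rewrite gL]. Qed.

Let addKs (s h : R) : s + h - s = h. Proof. by rewrite addrAC subrr add0r. Qed.

(** The increment [h] may be negative, so that one secant is a chord from either of its ends. *)
Definition chord s h : 'rV[R]_n := h^-1 *: (g (s + h) - g s).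

Lemma chord_sub K d s h : oscillation_le K d -> `|h| <= d -> h != 0 ->
  enorm (chord s h - derive1 g s) <= K.
Proof.
move=> od hd h0.
have -> : chord s h - derive1 g s =
    h^-1 *: (g (s + h) - g s - (s + h - s) *: derive1 g s).
  rewrite addKs scalerBr scalerA mulVf// scale1r.
  by rewrite /chord.
rewrite enormZ normfV mulrC ler_pdivrMr ?normr_gt0//.
have -> : `|h| = `|(s + h) - s| by rewrite addKs.
apply: curve_mvt_le => [|xi]; first exact: gC1.1.
rewrite addKs => hx; apply: od.
exact: le_trans hd.
Qed.

Lemma powR_split r : 0 < r -> r `^ e = r `^ k * r ^+ 2.
Proof.
move=> r0; rewrite -powR_mulrn ?ltW// -powRD ?subrK//.
by rewrite (gt_eqF r0) implybT.
Qed.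

(** Both chords are within [L / 4] of the tangent at [s], hence not short and at an acute angle.
    Flatness at radius [L * |h|] bounds their wedge, and [normalize_dist_le] turns this into a bound
    on directions. *)
Lemma chord_halving d s h : oscillation_le (L / 4) d -> `|h| <= d -> h != 0 ->
  enorm (normalize (chord s h) - normalize (chord s (h / 2))) <=
  8 * C * (L * `|h|) `^ k.
Proof.
have L0' := L0; have C0' := C0.
move=> od hd h0; have h20 : h / 2 != 0 by rewrite mulf_neq0 ?invr_neq0 ?pnatr_eq0.
have nh : 0 < `|h| by rewrite normr_gt0.
have hd2 : `|h / 2| = `|h| / 2 by rewrite normf_div normr_nat.
set A := chord s h; set B := chord s (h / 2); set v := derive1 g s.
have hA : enorm (A - v) <= L / 4 by exact: chord_sub od hd h0.
have hB : enorm (B - v) <= L / 4.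
  by apply: chord_sub od _ h20; rewrite hd2 (le_trans _ hd)// ler_pdivrMr//; lra.
have ev : enorm v = L by exact: gL.
have nA : 3 / 4 * L <= enorm A.
  by have := enorm_dist_le v A; rewrite enormBC ev; lra.
have nB : 3 / 4 * L <= enorm B.
  by have := enorm_dist_le v B; rewrite enormBC ev; lra.
have A0 : A != 0 by rewrite -enorm_gt0; lra.
have B0 : B != 0 by rewrite -enorm_gt0; lra.
(* Expanded around [v], the product is at least [L ^ 2 * (1 - 1/4 - 1/4 - 1/16)]. *)
have AB : 0 <= dotr A B.
  rewrite -(subrK v A) -(subrK v B) dotrDl !(dotrDr _ (B - v)).
  have h1 := dotr_geN (A - v) (B - v).
  have h2 := dotr_geN (A - v) v.
  have h3 := dotr_geN v (B - v).
  have h4 : dotr v v = L * L by rewrite -sqr_enorm ev expr2.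
  have h5 := ler_pM (enorm_ge0 _) (enorm_ge0 _) hA hB.
  have h6 := ler_wpM2r (ltW L0) hA.
  have h7 := ler_wpM2l (ltW L0) hB.
  have LL : 0 < L * L by rewrite mulr_gt0.
  rewrite ev in h2 h3; rewrite h4; lra.
have wAB : wedge A B <= 2 * C * (L * `|h|) `^ k * L ^+ 2.
  rewrite /A /B /chord wedgeZl wedgeZr !normfV hd2.
  have r0 : 0 < L * `|h| by rewrite mulr_gt0.
  have : wedge (g (s + h) - g s) (g (s + h / 2) - g s) <=
      C * (L * `|h|) `^ e.
    apply: gflat => //.
    - by rewrite (le_trans (lipg _ _))// addKs.
    - rewrite (le_trans (lipg _ _))// addKs hd2.
      by rewrite ler_pM2l//; lra.
    - rewrite (le_trans (lipg _ _))//.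
      have -> : s + h - (s + h / 2) = h / 2 by field.
      by rewrite hd2 ler_pM2l//; lra.
  rewrite powR_split//; set w := wedge _ _; set P := _ `^ k => hw.
  rewrite mulrA -invfM mulrC ler_pdivrMr; last by rewrite mulr_gt0// divr_gt0.
  by apply: le_trans hw _; rewrite le_eqVlt; apply/orP; left; apply/eqP; field.
apply: le_trans (normalize_dist_le A0 B0 AB) _.
rewrite ler_pdivrMr ?mulr_gt0 ?enorm_gt0//.
set P := _ `^ k in wAB *.
have P0 : 0 <= P by exact: powR_ge0.
have CP : 0 <= C * P by rewrite mulr_ge0// ltW.
(* The resulting constant is [2 * 2 / (3/4) ^ 2 = 64/9], which is below 8. *)
have nAB : (3 / 4 * L) * (3 / 4 * L) <= enorm A * enorm B.
  by rewrite ler_pM// mulr_ge0// ltW.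
rewrite -!mulrA in wAB *.
have := ler_wpM2l CP nAB; nra.
Qed.

(** The sum of the geometric series with first term [8 * C] and ratio [2 ^ (- k)], one term for each
    halving. *)
Definition holder_const := 8 * C / (1 - 2^-1 `^ k).

Lemma half_powR_lt1 : (2^-1 : R) `^ k < 1.
Proof.
have : (2^-1 : R) `^ k < 1 `^ k.
  by apply: gt0_ltr_powR => //; rewrite ?nnegrE ?invr_ge0// invf_lt1 ?ltr1n.
by rewrite powR1.
Qed.

Lemma holder_const_gt0 : 0 < holder_const.
Proof. by rewrite divr_gt0 ?mulr_gt0// subr_gt0 half_powR_lt1. Qed.

(** By the choice of [holder_const], the bound for one halving equals [holder_const] times the drop
    of [(L * |h|) ^ k], so the sum telescopes exactly. *)
Lemma chord_telescope d s h m : oscillation_le (L / 4) d -> `|h| <= d ->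
  h != 0 ->
  enorm (normalize (chord s h) - normalize (chord s (h / 2 ^+ m))) <=
  holder_const * ((L * `|h|) `^ k - (L * `|h / 2 ^+ m|) `^ k).
Proof.
move=> od hd h0; elim: m => [|m IH].
  by rewrite expr0 divr1 !subrr enorm0 mulr0.
set h' := h / 2 ^+ m.
have m0 : (2 : R) ^+ m != 0 by rewrite expf_neq0.
have h'0 : h' != 0 by rewrite mulf_neq0// invr_neq0.
have h'd : `|h'| <= d.
  rewrite (le_trans _ hd)// normrM normfV (ger0_norm (exprn_ge0 _ _))//.
  by rewrite ler_pdivrMr ?exprn_gt0// ler_peMr// exprn_ege1// ler1n.
have -> : h / 2 ^+ m.+1 = h' / 2 by rewrite exprSr invfM mulrA.
have := chord_halving s od h'd h'0.
have -> : (L * `|h' / 2|) `^ k = 2^-1 `^ k * (L * `|h'|) `^ k.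
  rewrite normf_div normr_nat mulrA mulrC [LHS]powRM ?invr_ge0//.
  by rewrite mulr_ge0// ltW.
move=> h1.
apply: le_trans (enormB_trans (normalize (chord s h')) _ _) _.
apply: le_trans (lerD IH h1) _.
have -> : 8 * C = holder_const * (1 - 2^-1 `^ k).
  by rewrite /holder_const divfK// subr_eq0 gt_eqF// half_powR_lt1.
rewrite le_eqVlt; apply/orP; left; apply/eqP; ring.
Qed.

(** Halving forever: the chords with increments [h / 2 ^+ m] tend to the tangent, while the
    telescoped bound is uniform in [m]. *)
Lemma chord_tangent d s h : oscillation_le (L / 4) d -> `|h| <= d -> h != 0 ->
  enorm (normalize (chord s h) - L^-1 *: derive1 g s) <=
  holder_const * (L * `|h|) `^ k.
Proof.
have L0' := L0; have C0' := C0.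
move=> od hd h0; apply/ler_addgt0Pr => eps eps0.
(* [normalize_lipschitz] doubles the oscillation and divides it by [L], which leaves [eps]. *)
have [d1 d10 od1] : exists2 d1, 0 < d1 & oscillation_le (L * eps / 2) d1.
  by apply: derive1_unif_continuous => //; [exact: gC1.2|rewrite divr_gt0// mulr_gt0].
have [m hm] : exists m, `|h / 2 ^+ m| <= d1.
  have [m hm] : exists m, `|h| / d1 < 2 ^+ m.
    exists (Num.bound (`|h| / d1)); rewrite (lt_le_trans (archi_boundP _))//.
      by rewrite divr_ge0// ltW.
    by rewrite -natrX ler_nat ltnW// ltn_expl.
  exists m; rewrite normrM normfV (ger0_norm (exprn_ge0 _ _))//.
  by rewrite ler_pdivrMr ?exprn_gt0// mulrC -ler_pdivrMr// ltW.
have m0 : (2 : R) ^+ m != 0 by rewrite expf_neq0.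
have h'0 : h / 2 ^+ m != 0 by rewrite mulf_neq0// invr_neq0.
have v0 : derive1 g s != 0 by rewrite -enorm_gt0 gL.
have h2 := normalize_lipschitz (chord s (h / 2 ^+ m)) v0.
have h3 := chord_sub s od1 hm h'0.
rewrite /normalize gL in h2.
apply: le_trans (enormB_trans (normalize (chord s (h / 2 ^+ m))) _ _) _.
apply: lerD.
  apply: le_trans (chord_telescope s m od hd h0) _.
  by rewrite ler_pM2l ?holder_const_gt0// gerBl powR_ge0.
apply: le_trans h2 _; rewrite ler_pdivrMr//; lra.
Qed.

(** The secant through [g s] and [g t] is a chord at both points, so [chord_tangent] compares it
    with both tangents. *)
Lemma tangent_holder d s t : oscillation_le (L / 4) d -> `|s - t| <= d ->
  enorm (derive1 g s - derive1 g t) <=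
  2 * L * holder_const * (L * `|s - t|) `^ k.
Proof.
move=> od std; have [->|st] := eqVneq s t.
  rewrite !subrr enorm0 mulr_ge0 ?powR_ge0//.
  by rewrite mulr_ge0 ?(ltW holder_const_gt0)// mulr_ge0// ltW.
have h0 : t - s != 0 by rewrite subr_eq0 eq_sym.
have h1 : s - t != 0 by rewrite subr_eq0.
have c1 : chord s (t - s) = chord t (s - t).
  rewrite /chord !subrKC -(opprB t s) invrN scaleNr -scalerN opprB.
  by [].
have tsd : `|t - s| <= d by rewrite distrC.
have hs := chord_tangent s od tsd h0.
have ht := chord_tangent t od std h1.
rewrite c1 (distrC t s) enormBC in hs.
have -> : derive1 g s - derive1 g t =
    L *: (L^-1 *: derive1 g s - L^-1 *: derive1 g t).
  by rewrite -scalerBr scalerA mulfV ?gt_eqF// scale1r.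
rewrite enormZ gtr0_norm//; move: (holder_const) hs ht => H hs ht.
rewrite -!mulrA mulrCA ler_pM2l// mulr_natl mulr2n.
apply: le_trans (lerD hs ht); exact: enormB_trans.
Qed.

(** Below this scale [holder_const * (L * d) ^ k] is at most [1/16], so [tangent_holder] improves an
    oscillation [L / 4] to [L / 8]. The cap [1/2] is half the period. *)
Definition bootstrap_scale : R :=
  Num.min 2^-1 ((16 * holder_const)^-1 `^ k^-1 / L).

Lemma bootstrap_scale_gt0 : 0 < bootstrap_scale.
Proof.
rewrite lt_min invr_gt0 ltr0n/= divr_gt0// powR_gt0// invr_gt0 mulr_gt0//.
exact: holder_const_gt0.
Qed.

Lemma powR_bootstrap_scale (d : R) : 0 <= d <= bootstrap_scale ->
  holder_const * (L * d) `^ k <= 16^-1.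
Proof.
move=> /andP[d0]; rewrite le_min ler_pdivlMr// => /andP[_ dH].
have H0 := holder_const_gt0.
rewrite mulrC in dH; have : (L * d) `^ k <= ((16 * holder_const)^-1 `^ k^-1) `^ k.
  by apply: ge0_ler_powR => //; rewrite ?nnegrE ?powR_ge0 ?mulr_ge0// ltW.
have H16 : 0 <= (16 * holder_const)^-1.
  by rewrite invr_ge0; apply: mulr_ge0; [|exact: ltW].
rewrite -powRrM mulVf ?(gt_eqF k0)// (powRr1 H16) => h.
rewrite mulrC -ler_pdivlMr//; apply: le_trans h _.
by rewrite invfM.
Qed.

(* The oscillation bound [L / 4] is self-improving: flatness turns it into a
   Hölder bound, hence the same bound on arcs of twice the length. *)
Lemma oscillation_bootstrap : oscillation_le (L / 4) bootstrap_scale.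
Proof.
have L0' := L0; have C0' := C0.
have [d1 d10 od1] : exists2 d1, 0 < d1 & oscillation_le (L / 4) d1.
  by apply: derive1_unif_continuous => //; [exact: gC1.2|rewrite divr_gt0].
(* [d1] depends on the curve, but each doubling keeps the bound [L / 4]; the doublings stop at a
   scale depending on [C], [e] and [L] only. *)
have od m : oscillation_le (L / 4) (Num.min (2 ^+ m * d1) bootstrap_scale).
  elim: m => [|m IH] s t.
    by rewrite expr0 mul1r le_min => /andP[/od1].
  rewrite exprS -mulrA le_min => /andP[st1 st2].
  (* The induction hypothesis applies on both halves of the arc; each contributes [L / 8]. *)
  set mid := (s + t) / 2.
  have sm : `|s - mid| = `|s - t| / 2.
    have -> : s - mid = (s - t) / 2 by rewrite /mid; field.
    by rewrite normf_div normr_nat.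
  have tm : `|mid - t| = `|s - t| / 2.
    have -> : mid - t = (s - t) / 2 by rewrite /mid; field.
    by rewrite normf_div normr_nat.
  have b0 := bootstrap_scale_gt0.
  have st2b : `|s - t| / 2 <= bootstrap_scale by have := normr_ge0 (s - t); lra.
  have std : `|s - t| / 2 <= Num.min (2 ^+ m * d1) bootstrap_scale.
    by rewrite le_min st2b andbT; lra.
  have h1 : 0 <= `|s - t| / 2 <= bootstrap_scale by rewrite divr_ge0.
  have h2 := powR_bootstrap_scale h1.
  have h3 : enorm (derive1 g s - derive1 g mid) <= L / 8.
    apply: le_trans (tangent_holder IH _) _; rewrite sm//.
    move: (holder_const) h2 => H h2.
    by rewrite -!mulrA mulrCA ler_pM2l//; lra.
  have h4 : enorm (derive1 g mid - derive1 g t) <= L / 8.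
    apply: le_trans (tangent_holder IH _) _; rewrite tm//.
    move: (holder_const) h2 => H h2.
    by rewrite -!mulrA mulrCA ler_pM2l//; lra.
  have -> : L / 4 = L / 8 + L / 8 by field.
  exact: (le_trans (enormB_trans (derive1 g mid) _ _) (lerD h3 h4)).
have [m hm] : exists m, bootstrap_scale / d1 < 2 ^+ m.
  exists (Num.bound (bootstrap_scale / d1)).
  rewrite (lt_le_trans (archi_boundP _))//.
    by rewrite divr_ge0// ltW// bootstrap_scale_gt0.
  by rewrite -natrX ler_nat ltnW// ltn_expl.
move=> s t st; apply: (od m); rewrite le_min st andbT.
by rewrite (le_trans st)// -ler_pdivrMr// ltW.
Qed.

(** * Lower bounds for the distance of two points *)

Hypothesis ginj : curve_injective g.

Lemma chord_lower s h : `|h| <= bootstrap_scale ->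
  3 / 4 * L * `|h| <= enorm (g (s + h) - g s).
Proof.
have L0' := L0; have C0' := C0.
move=> hd; have [->|h0] := eqVneq h 0; first by rewrite normr0 mulr0 enorm_ge0.
have h1 := chord_sub s oscillation_bootstrap hd h0.
have h2 := enorm_dist_le (derive1 g s) (chord s h).
rewrite enormBC gL in h2.
have : 3 / 4 * L <= enorm (chord s h) by lra.
by rewrite /chord enormZ normfV [X in _ <= X]mulrC ler_pdivlMr ?normr_gt0.
Qed.

(** The first entry is the bound of [chord_lower] at [bootstrap_scale]; the second is the distance
    [d] with [(2 * d) ^ k = 3 / (16 * C)], below which flatness contradicts orthogonality. *)
Definition separation : R :=
  Num.min (3 / 4 * L * bootstrap_scale) ((3 / (16 * C)) `^ k^-1 / 2).

Lemma separation_gt0 : 0 < separation.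
Proof.
have h := bootstrap_scale_gt0.
by rewrite lt_min !mulr_gt0//= powR_gt0// divr_gt0// mulr_gt0.
Qed.

(* At a local minimum of the distance to [g t] the secant is orthogonal to the
   tangent, so [g s, g t, g (s + h)] with [h] comparable to the distance is far
   from being flat. *)
Lemma perpendicular_far s t : g s != g t ->
  dotr (derive1 g s) (g s - g t) = 0 -> separation <= enorm (g s - g t).
Proof.
have L0' := L0; have C0' := C0.
rewrite -subr_eq0 => st0 perp; rewrite ge_min.
set d := enorm (g s - g t).
have d0 : 0 < d by rewrite enorm_gt0.
have b0 := bootstrap_scale_gt0.
have [dL|dL] := lerP (L * bootstrap_scale) d.
  by apply/orP; left; rewrite (le_trans _ dL)// -mulrA ler_piMl// ?mulr_ge0 ?ltW//; lra.
apply/orP; right.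
(* The arc from [s] to [s + h] has length [d], so the three points lie within [2 * d] of each
   other. *)
set h := d / L.
have h0 : 0 < h by rewrite divr_gt0.
have nh : `|h| = h by rewrite gtr0_norm.
have hb : `|h| <= bootstrap_scale by rewrite nh ler_pdivrMr// mulrC ltW.
have hL : L * h = d by rewrite /h mulrCA mulfV ?gt_eqF// mulr1.
have l1 : enorm (g (s + h) - g s) <= d.
  by rewrite (le_trans (lipg _ _))// addKs nh hL.
have d20 : 0 < 2 * d by rewrite mulr_gt0.
have fl : wedge (g t - g s) (g (s + h) - g s) <= C * (2 * d) `^ e.
  apply: gflat => //.
  - by rewrite enormBC -/d; lra.
  - by lra.
  - rewrite (le_trans (enormB_trans (g s) _ _))//.
    by rewrite enormBC -/d (enormBC (g s)); lra.
rewrite powR_split// in fl.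
have h1 : enorm (g (s + h) - g s - h *: derive1 g s) <= d / 4.
  have := chord_sub s oscillation_bootstrap hb (lt0r_neq0 h0).
  have -> : g (s + h) - g s - h *: derive1 g s = h *: (chord s h - derive1 g s).
    by rewrite scalerBr /chord scalerA mulfV ?gt_eqF// scale1r.
  by rewrite enormZ nh => /(ler_wpM2l (ltW h0)) h1; rewrite (le_trans h1)// -hL; lra.
(* By orthogonality the secant and the tangent step span a square of side [d]. Replacing the tangent
   step by the chord costs at most [d ^ 2 / 4], so flatness requires
   [3/4 <= 4 * C * (2 * d) ^ k]. *)
have w1 : wedge (g t - g s) (h *: derive1 g s) = d * d.
  rewrite wedgeZr nh /wedge gL (enormBC (g t)) -/d.
  rewrite -(opprB (g s)) dotrNl dotrC perp oppr0 expr0n/= subr0 -exprMn sqrtr_sqr.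
  by rewrite ger0_norm ?mulr_ge0 ?ltW// mulrCA (mulrC h) hL.
have w2 := wedgeDr (g t - g s) (g (s + h) - g s)
  (h *: derive1 g s - (g (s + h) - g s)).
rewrite subrKC w1 in w2.
have w3 := wedge_le (g t - g s) (h *: derive1 g s - (g (s + h) - g s)).
rewrite (enormBC (h *: _)) (enormBC (g t)) -/d in w3.
rewrite leNgt; apply/negP => dC.
have : (2 * d) `^ k < ((3 / (16 * C)) `^ k^-1) `^ k.
  apply: gt0_ltr_powR => //; rewrite ?nnegrE ?powR_ge0 ?(ltW d20)//; lra.
rewrite -powRrM mulVf ?gt_eqF// powRr1; last by rewrite divr_ge0 ?mulr_ge0 ?ltW.
rewrite ltr_pdivlMr ?mulr_gt0// => hP.
set P := (2 * d) `^ k in fl hP.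
have w4 : d * enorm (g (s + h) - g s - h *: derive1 g s) <= d * (d / 4).
  by rewrite ler_pM2l.
have w5 : d * d * 3 <= 16 * (C * P) * (d * d) by nra.
have : d * d * (P * (16 * C)) < d * d * 3 by rewrite ltr_pM2l ?mulr_gt0.
have -> : d * d * (P * (16 * C)) = 16 * (C * P) * (d * d) by ring.
by rewrite ltNge w5.
Qed.

(** For fixed [t] the distance to [g t] is minimized over the arc [[t + b, t + 1 - b]], where [b] is
    [bootstrap_scale]. At the ends [chord_lower] applies, at the right one after a shift by a
    period; at an interior minimum [perpendicular_far] applies. *)
Lemma far_separation s t : bootstrap_scale <= `|s - t| <= 1 - bootstrap_scale ->
  separation <= enorm (g s - g t).
Proof.
have L0' := L0; have C0' := C0.
wlog ts : s t / t <= s.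
  move=> H; have [|/ltW] := leP t s; first exact: H.
  by move=> /H{}H; rewrite distrC enormBC.
have b0 := bootstrap_scale_gt0.
rewrite ger0_norm ?subr_ge0// => /andP[st1 st2].
set b := bootstrap_scale in b0 st1 st2.
have ab : t + b <= t + 1 - b by lra.
have cf : continuous (fun u => enorm (g u - g t)).
  move=> u; apply: (@continuous_comp _ _ _ (fun u => g u - g t) (@enorm R n)).
    by apply: cvgB; [exact: (derivable_curve_continuous gC1.1)|exact: cvg_cst].
  exact: enorm_continuous.
have [c c1 c2] := EVT_min ab (continuous_subspaceT cf).
apply: le_trans (c2 s _); last by rewrite in_itv/=; apply/andP; split; lra.
move: c1; rewrite in_itv/= => /andP[c3 c4].
have sepb : separation <= 3 / 4 * L * `|b|.
  by rewrite (gtr0_norm b0) /separation ge_min lexx.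
have [->|cb1] := eqVneq c (t + b).
  by apply: le_trans sepb _; apply: chord_lower; rewrite gtr0_norm.
have [->|cb2] := eqVneq c (t + 1 - b).
  apply: le_trans sepb _; rewrite -normrN -addrA (addrC 1) addrA gp.
  by apply: chord_lower; rewrite normrN gtr0_norm.
have cin : c \in `](t + b), (t + 1 - b)[.
  by rewrite in_itv/= !lt_neqAle c3 c4 eq_sym cb1 cb2.
(* Injectivity is given on [[0, 1[] only. Once [t - m] is there, [c - m] lies between 0 and 2, so
   either it or [c - m - 1] is there too. *)
have gct : g c != g t.
  apply/eqP => gct.
  have [m /andP[m0 m1]] := fract_itv t.
  have e1 : g (t - m%:~R) = g t by rewrite -(periodic_int gp t (- m)) rmorphN.
  have e2' : g (c - m%:~R) = g c by rewrite -(periodic_int gp c (- m)) rmorphN.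
  have tin : t - m%:~R \in `[0, 1[ by rewrite in_itv/= m0 m1.
  have [cm|cm] := ltP (c - m%:~R) 1.
    have cin' : c - m%:~R \in `[0, 1[ by rewrite in_itv/= cm andbT; lra.
    have : c - m%:~R = t - m%:~R by apply: (ginj cin' tin); rewrite e1 e2'.
    by lra.
  have cin' : c - m%:~R - 1 \in `[0, 1[.
    by rewrite in_itv/=; apply/andP; split; lra.
  have : c - m%:~R - 1 = t - m%:~R.
    by apply: (ginj cin' tin); rewrite -gp subrK e1 e2'.
  by lra.
apply: perpendicular_far => //.
set a := g c - g t.
(* [f] replaces the squared distance: as [|g u - g c| <= L * |u - c|], a minimum of the distance at
   [c] is a minimum of [f], whose derivative at [c] is the wanted inner product. *)
pose f u := dotr (g u) a + L ^+ 2 / 2 * (u - c) ^+ 2.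
have df (u : R) : is_derive u 1 f (dotr (derive1 g u) a + L ^+ 2 / 2 * (2 * (u - c))).
  apply: is_deriveD; first exact: (is_derive_dotr gC1.1).
  apply: is_derive_eq; rewrite /GRing.scale/=; ring.
have fmin u : u \in `](t + b), (t + 1 - b)[ -> f c <= f u.
  move=> uin.
  have := c2 u; rewrite -(@ler_pXn2r _ 2) ?nnegrE ?enorm_ge0// => h.
  have {}h : enorm (g c - g t) ^+ 2 <= enorm (g u - g t) ^+ 2.
    by apply: h; move: uin; rewrite !in_itv/= => /andP[? ?]; rewrite !ltW.
  have -> : f u = f c + (dotr (g u - g c) a + L ^+ 2 / 2 * (u - c) ^+ 2).
    rewrite /f subrr expr0n/= mulr0 addr0 addrA; congr (_ + _).
    by rewrite -dotrDl subrKC.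
  have ua : g u - g t = (g u - g c) + a by rewrite /a addrA subrK.
  rewrite ua -/a sqr_enormD in h.
  have := lipg c u; rewrite -(@ler_pXn2r _ 2) ?nnegrE ?enorm_ge0//; last first.
    by rewrite mulr_ge0// ltW.
  rewrite exprMn real_normK ?num_real// lerDl; lra.
have dfu u : u \in `](t + b), (t + 1 - b)[ -> derivable f u 1.
  by move=> _; have [] := df u.
have fd : is_derive c 1 f 0 by exact: derive1_at_min ab dfu cin fmin.
have [_ <-] := fd; have [_ ->] := df c.
by rewrite subrr !mulr0 addr0.
Qed.

Definition bilipschitz_const : R := Num.min (3 / 4 * L) separation.

Lemma bilipschitz_const_gt0 : 0 < bilipschitz_const.
Proof. by rewrite lt_min separation_gt0 andbT !mulr_gt0. Qed.

(** Half a period is the largest distance on the circle. Up to [bootstrap_scale] the bound is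
    [chord_lower], beyond it [far_separation], since [|s - t| <= 1]. *)
Lemma flat_bilipschitz s t : `|s - t| <= 2^-1 ->
  bilipschitz_const * `|s - t| <= enorm (g s - g t).
Proof.
have L0' := L0; have C0' := C0.
move=> st; have c0 := bilipschitz_const_gt0.
have [stb|/ltW stb] := leP `|s - t| bootstrap_scale.
  have -> : g s = g (t + (s - t)) by rewrite subrKC.
  apply: le_trans (chord_lower t stb).
  by rewrite ler_wpM2r// ge_min lexx.
apply: le_trans (far_separation (_ : _ <= `|s - t| <= _)); last first.
  have : bootstrap_scale <= 2^-1 by rewrite ge_min lexx.
  by rewrite stb/=; lra.
apply: (@le_trans _ _ bilipschitz_const); last by rewrite ge_min lexx orbT.
by rewrite ler_piMr ?(ltW c0)// (le_trans st)// invf_le1// ler1n.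
Qed.

Lemma flat_holder s t : `|s - t| <= bootstrap_scale ->
  enorm (derive1 g s - derive1 g t) <=
  2 * L * holder_const * (L * `|s - t|) `^ k.
Proof. exact/tangent_holder/oscillation_bootstrap. Qed.

End flat_curve.

(** * Bounded energy implies flatness *)

Section measurability.
Context {R : realType} {n : nat}.

Lemma measurable_fun_dotr d (T : measurableType d) (x y : T -> 'rV[R]_n) :
  (forall i, measurable_fun setT (fun u => x u ord0 i)) ->
  (forall i, measurable_fun setT (fun u => y u ord0 i)) ->
  measurable_fun setT (fun u => dotr (x u) (y u)).
Proof.
move=> mx my; apply: measurable_sum => i; exact: measurable_funM.
Qed.

Lemma measurable_fun_sqrtr d (T : measurableType d) (f : T -> R) :
  measurable_fun setT f -> measurable_fun setT (fun u => Num.sqrt (f u)).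
Proof.
move=> mf; apply: measurableT_comp mf.
by apply: continuous_measurable_fun; exact: sqrt_continuous.
Qed.

Lemma measurable_fun_enorm d (T : measurableType d) (x : T -> 'rV[R]_n) :
  (forall i, measurable_fun setT (fun u => x u ord0 i)) ->
  measurable_fun setT (fun u => enorm (x u)).
Proof. by move=> mx; apply: measurable_fun_sqrtr; exact: measurable_fun_dotr. Qed.

Lemma measurable_fun_wedge d (T : measurableType d) (x y : T -> 'rV[R]_n) :
  (forall i, measurable_fun setT (fun u => x u ord0 i)) ->
  (forall i, measurable_fun setT (fun u => y u ord0 i)) ->
  measurable_fun setT (fun u => wedge (x u) (y u)).
Proof.
move=> mx my; apply: measurable_fun_sqrtr; apply: measurable_funB.
  by apply: measurable_funM; apply: measurable_funX; exact: measurable_fun_enorm.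
by apply: measurable_funX; exact: measurable_fun_dotr.
Qed.

Lemma measurable_coord (f : R -> 'rV[R]_n) i : continuous f ->
  measurable_fun setT (fun t => f t ord0 i).
Proof.
move=> cf; apply: continuous_measurable_fun => t.
by apply: (@continuous_comp _ _ _ f (fun a : 'rV[R]_n => a ord0 i));
  [exact: cf|exact: coord_continuous].
Qed.

Lemma measurable_intM_density (p q : R) (g : R -> 'rV[R]_n) : curve_C1 g ->
  measurable_fun setT (fun u : R * R * R => intM_density p q g u.1.1 u.1.2 u.2).
Proof.
move=> [dg cg].
have mg := fun i => measurable_coord i (derivable_curve_continuous dg).
have mg' := fun i => measurable_coord i cg.
have m1 : measurable_fun setT (fun u : R * R * R => u.1.1).
  by apply: measurableT_comp; exact: measurable_fst.
have m2 : measurable_fun setT (fun u : R * R * R => u.1.2).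
  by apply: measurableT_comp; [exact: measurable_snd|exact: measurable_fst].
have m3 : measurable_fun setT (fun u : R * R * R => u.2) by exact: measurable_snd.
have mB (x y : R * R * R -> R) : measurable_fun setT x -> measurable_fun setT y ->
    forall i, measurable_fun setT (fun u => (g (x u) - g (y u)) ord0 i).
  move=> mx my i; under eq_fun do rewrite mxE [X in _ + X]mxE.
  by apply: measurable_funB; exact: (measurableT_comp (mg i)).
have mD (x : R * R * R -> R) : measurable_fun setT x ->
    measurable_fun setT (fun u => enorm (derive1 g (x u))).
  by move=> mx; apply: measurable_fun_enorm => i; exact: (measurableT_comp (mg' i)).
rewrite /intM_density /=.
apply: measurable_funM; last first.
  by apply: measurable_funM; [apply: measurable_funM|]; exact: mD.
apply: measurable_funM.
  apply: (measurableT_comp (measurable_powR q)).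
  by apply: measurable_fun_wedge => i; exact: mB.
under eq_fun do rewrite -powRN.
apply: (measurableT_comp (measurable_powR (- p))).
by apply: measurable_funM; [apply: measurable_funM|];
  apply: measurable_fun_enorm => i; exact: mB.
Qed.

Lemma intM_density_ge0 (p q : R) (g : R -> 'rV[R]_n) u1 u2 u3 :
  0 <= intM_density p q g u1 u2 u3.
Proof.
by rewrite mulr_ge0 ?divr_ge0 ?powR_ge0 ?mulr_ge0// enorm_ge0.
Qed.

End measurability.

Lemma box_integral_ge (R : realType) (f : R * R * R -> R) (K : R)
    (a1 b1 a2 b2 a3 b3 : R) :
  measurable_fun setT f -> (forall u, 0 <= f u) -> 0 <= K ->
  0 <= a1 <= b1 /\ b1 <= 1 -> 0 <= a2 <= b2 /\ b2 <= 1 ->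
  0 <= a3 <= b3 /\ b3 <= 1 ->
  (forall u1 u2 u3, a1 <= u1 <= b1 -> a2 <= u2 <= b2 -> a3 <= u3 <= b3 ->
    K <= f (u1, u2, u3)) ->
  ((K * ((b1 - a1) * (b2 - a2) * (b3 - a3)))%:E <=
  \int[(@lebesgue_measure R) \x (@lebesgue_measure R)
          \x (@lebesgue_measure R)]_(u in (`[0%R, 1%R] `*` `[0%R, 1%R]) `*` `[0%R, 1%R])
     (f u)%:E)%E.
Proof.
move=> mf f0 K0 [/andP[a10 ab1] b11] [/andP[a20 ab2] b21] [/andP[a30 ab3] b31] fK.
have mi (a b : R) : measurable (`[a, b]%classic : set R) by exact: measurable_itv.
have mbox : measurable ((`[a1, b1] `*` `[a2, b2]) `*` `[a3, b3] : set (R * R * R)).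
  by apply: measurableX; [apply: measurableX|]; exact: mi.
have mcube : measurable ((`[0%R, 1%R] `*` `[0%R, 1%R]) `*` `[0%R, 1%R] : set (R * R * R)).
  by apply: measurableX; [apply: measurableX|]; exact: mi.
have mfE : measurable_fun setT (EFin \o f) by exact/measurable_EFinP.
set mu := (X in (_ <= \int[X]_(u in _) _)%E).
apply: (@le_trans _ _
  (\int[mu]_(u in (`[a1, b1] `*` `[a2, b2]) `*` `[a3, b3]) (f u)%:E)%E); last first.
  apply: ge0_subset_integral => //.
  - exact: measurable_funTS.
  - by move=> u _; rewrite lee_fin.
  - move=> [[u1 u2] u3] /= [[]]; rewrite !in_itv/= => /andP[? ?] /andP[? ?] /andP[? ?].
    by split; [split|]; apply/andP; split; lra.
have lm (a b : R) : a <= b -> lebesgue_measure (`[a, b]%classic : set R) = (b - a)%:E.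
  move=> ab; rewrite lebesgue_measure_itv/= lte_fin; case: ltP => // ba.
  by have -> : a = b by [apply/le_anti/andP]; rewrite subrr.
apply: (@le_trans _ _ (\int[mu]_(u in (`[a1, b1] `*` `[a2, b2]) `*` `[a3, b3]) (cst K%:E) u)%E).
  rewrite integral_cst//.
  rewrite [X in (_ <= _ * X)%E](_ : _ =
      (((b1 - a1) * (b2 - a2))%:E * (b3 - a3)%:E)%E).
    by rewrite -!EFinM.
  rewrite [LHS]product_measure1E//; last exact: measurableX.
  rewrite [X in (X * _)%E]product_measure1E// EFinM.
  by congr ((_ * _) * _)%E; exact: lm.
apply: ge0_le_integral => //.
- exact: measurable_funTS.
- move=> [[u1 u2] u3] /= [[]]; rewrite !in_itv/= lee_fin; exact: fK.
Qed.

(** The interval has to stay in [[0, 1]], so it is put to the right of [u] when [u <= 1/2] and to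
    the left otherwise. *)
Lemma subinterval_near (R : realType) (u w : R) : 0 <= u <= 1 -> 0 <= w <= 2^-1 ->
  exists2 a : R, 0 <= a <= a + w /\ a + w <= 1 &
    forall v, a <= v <= a + w -> `|v - u| <= w.
Proof.
move=> /andP[u0 u1] /andP[w0 w1].
have [u2|u2] := leP u 2^-1.
  exists u; first by split; [apply/andP; split|]; lra.
  by move=> v /andP[? ?]; rewrite ler_norml; apply/andP; split; lra.
exists (u - w); first by split; [apply/andP; split|]; lra.
by move=> v /andP[? ?]; rewrite ler_norml; apply/andP; split; lra.
Qed.

(** Solving [(W / 2) ^ q / (8 * r ^ 3) ^ p * L ^ 3 * w ^ 3 <= M] with [w = W / (16 * r * L)] for [W]
    gives this constant and the power [flat_exponent] of [r]; the speed [L] cancels. *)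
Definition flat_const (R : realType) (p q M : R) : R :=
  (M * 2 `^ q * 8 `^ p * 16 ^+ 3) `^ (q + 3)^-1.

Definition flat_exponent (R : realType) (p q : R) : R := (3 * p + 3) / (q + 3).

Lemma wedge_self (R : realType) (n : nat) (a : 'rV[R]_n) : wedge a a = 0.
Proof. by rewrite /wedge -!sqr_enorm -expr2 subrr sqrtr0. Qed.

Section energy_flat.
Context {R : realType} {n : nat}.
Variables (p q M L : R) (g : R -> 'rV[R]_n).
Hypotheses (p0 : 0 < p) (q0 : 0 < q) (M0 : 0 < M) (L0 : 0 < L).
Hypotheses (gp : closed_curve g) (gC1 : curve_C1 g).
Hypothesis gL : forall u, enorm (derive1 g u) = L.
Hypothesis gM : (intM p q g <= M%:E)%E.

Let lipg (s t : R) : enorm (g t - g s) <= L * `|t - s|.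
Proof. by apply: curve_lipschitz => [|u]; [exact: gC1.1|rewrite gL]. Qed.

Let addKs (s h : R) : s + h - s = h. Proof. by rewrite addrAC subrr add0r. Qed.

(* Moving the three parameters by [w = W / (16 r L)], where [W] is the value of
   the wedge, preserves [W] up to a factor 2; the energy of this box of
   parameters bounds a power of [W / r ^ flat_exponent]. *)
Lemma energy_flat_unit (u1 u2 u3 r : R) : 0 <= u1 <= 1 -> 0 <= u2 <= 1 -> 0 <= u3 <= 1 ->
  0 < r -> enorm (g u2 - g u1) <= r -> enorm (g u3 - g u1) <= r ->
  enorm (g u2 - g u3) <= r ->
  wedge (g u2 - g u1) (g u3 - g u1) <= flat_const p q M * r `^ flat_exponent p q.
Proof.
move=> hu1 hu2 hu3 r0 r21 r31 r23; have L0' := L0.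
set W := wedge _ _.
have W0 : 0 <= W by exact: wedge_ge0.
have [W00|Wn0] := eqVneq W 0; first by rewrite W00 mulr_ge0// powR_ge0.
have {Wn0}W0 : 0 < W by rewrite lt_def Wn0.
have Wrr : W <= r * r.
  by apply: le_trans (wedge_le _ _) _; rewrite ler_pM// enorm_ge0.
(* Parameters in [[0, 1]] give points at distance at most [L]; hence [w <= 1/16] below, as
   [subinterval_near] demands. *)
have WLr : W <= L * r.
  apply: le_trans (wedge_le _ _) _; rewrite ler_pM ?enorm_ge0//.
  apply: le_trans (lipg _ _) _; rewrite ler_piMr ?(ltW L0)// ler_norml.
  by move: hu1 hu2 => /andP[? ?] /andP[? ?]; apply/andP; split; lra.
set w := W / (16 * (r * L)).
have rL0 : 0 < r * L by rewrite mulr_gt0.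
have w0 : 0 < w by rewrite divr_gt0// mulr_gt0.
have w2 : 0 <= w <= 2^-1.
  by rewrite (ltW w0)/= ler_pdivrMr ?mulr_gt0//; lra.
(* Both endpoints of a secant move by at most [L * w], so the secant changes by at most [d]. *)
set d := W / (8 * r).
have Lw : 2 * (L * w) = d by rewrite /w /d; field; rewrite (gt_eqF r0) (gt_eqF L0).
have d0 : 0 < d by rewrite divr_gt0// mulr_gt0.
have dr : d * r = W / 8 by rewrite /d; field; rewrite gt_eqF.
have dr8 : d <= r / 8.
  by rewrite -(ler_pM2r r0) dr; lra.
have [a1 [a1l a1r] ha1] := subinterval_near hu1 w2.
have [a2 [a2l a2r] ha2] := subinterval_near hu2 w2.
have [a3 [a3l a3r] ha3] := subinterval_near hu3 w2.
have near u v : `|v - u| <= w -> enorm (g v - g u) <= L * w.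
  by move=> uv; apply: le_trans (lipg _ _) _; rewrite ler_pM2l.
have diff u v u' v' : `|u' - u| <= w -> `|v' - v| <= w ->
    enorm ((g u - g v) - (g u' - g v')) <= d.
  move=> uu vv; have -> : g u - g v - (g u' - g v') = (g v' - g v) - (g u' - g u).
    by apply/rowP => i; rewrite !mxE; ring.
  by apply: le_trans (enormB _ _) _; rewrite -Lw mulr_natl mulr2n lerD// near.
set K := (W / 2) `^ q / ((2 * r) ^+ 3) `^ p * L ^+ 3.
have K0 : 0 <= K.
  by rewrite mulr_ge0 ?divr_ge0 ?powR_ge0// exprn_ge0// ltW.
have fK v1 v2 v3 : a1 <= v1 <= a1 + w -> a2 <= v2 <= a2 + w ->
    a3 <= v3 <= a3 + w -> K <= intM_density p q g v1 v2 v3.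
  move=> /ha1 hv1 /ha2 hv2 /ha3 hv3.
  rewrite /intM_density !gL.
  have -> : L * L * L = L ^+ 3 by rewrite !exprS expr0 mulr1 mulrA.
  rewrite ler_pM2r ?exprn_gt0//.
  (* The error [d * (2 * r + d)] is at most [W / 4 + W / 64]. *)
  have W2 : W / 2 <= wedge (g v2 - g v1) (g v3 - g v1).
    have := wedge_perturb r21 r31 (diff _ _ _ _ hv2 hv1) (diff _ _ _ _ hv3 hv1).
    rewrite -/W; have : d * d <= d * (r / 8) by rewrite ler_pM2l.
    rewrite (mulrDr d) (mulrA d r); lra.
  have W20 : 0 < W / 2 by rewrite divr_gt0.
  have far u u' v v' : `|v - u| <= w -> `|v' - u'| <= w ->
      enorm (g u - g u') <= r -> enorm (g v - g v') <= 2 * r.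
    move=> vu vu' uu'; have := diff _ _ _ _ vu vu'.
    have := enorm_dist_le (g v - g v') (g u - g u'); rewrite (enormBC (g v - _)); lra.
  have D23 := far _ _ _ _ hv2 hv3 r23.
  have D21 := far _ _ _ _ hv2 hv1 r21.
  have D31 := far _ _ _ _ hv3 hv1 r31.
  have W' := lt_le_trans W20 W2.
  (* A positive wedge keeps the three points distinct, so [D] is positive and the convention for
     division by 0 does not intervene. *)
  have pos (a b : 'rV[R]_n) : 0 < wedge a b -> a != 0.
    move=> wab; apply/eqP => a0; have := wedge_le a b.
    by rewrite a0 enorm0 mul0r leNgt -a0 wab.
  have n21 : g v2 - g v1 != 0 by exact: pos W'.
  have n31 : g v3 - g v1 != 0 by apply: (pos _ (g v2 - g v1)); rewrite wedgeC.
  have n23 : g v2 - g v3 != 0.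
    rewrite subr_eq0; apply/eqP => n23.
    by move: W'; rewrite n23 wedge_self ltxx.
  set D := enorm _ * _ * _.
  have D0 : 0 < D by rewrite !mulr_gt0 ?enorm_gt0.
  have Dr : D <= (2 * r) ^+ 3.
    by rewrite !exprSr expr0 mul1r !ler_pM ?mulr_ge0 ?enorm_ge0.
  apply: ler_pM; rewrite ?powR_ge0 ?invr_ge0 ?powR_ge0//.
    by apply: ge0_ler_powR; rewrite ?nnegrE ?wedge_ge0 ?(ltW q0) ?(ltW W20).
  rewrite lef_pV2 ?posrE ?powR_gt0//; last by rewrite exprn_gt0// mulr_gt0.
  by apply: ge0_ler_powR; rewrite ?nnegrE ?(ltW p0) ?(ltW D0)// exprn_ge0// mulr_ge0// ltW.
have := box_integral_ge (f := fun u => intM_density p q g u.1.1 u.1.2 u.2)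
  (measurable_intM_density p q gC1) (fun u => intM_density_ge0 p q g _ _ _) K0
  (conj a1l a1r) (conj a2l a2r) (conj a3l a3r) fK.
move=> /le_trans/(_ gM); rewrite lee_fin !addKs => KM.
have h1 : W `^ (q + 3) = W `^ q * W ^+ 3.
  by rewrite powRD ?powR_mulrn ?(ltW W0)// (gt_eqF W0) implybT.
have h2 : r `^ (3 * p + 3) = r `^ (3 * p) * r ^+ 3.
  by rewrite powRD ?powR_mulrn ?(ltW r0)// (gt_eqF r0) implybT.
have h3 : (W / 2) `^ q = W `^ q / 2 `^ q.
  by rewrite powRM ?invr_ge0 ?(ltW W0)// -powR_inv1// -powRrM mulN1r powRN.
have h4 : ((2 * r) ^+ 3) `^ p = 8 `^ p * r `^ (3 * p).
  rewrite exprMn powRM ?exprn_ge0 ?(ltW r0)//; congr (_ `^ _ * _).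
    by rewrite -natrX.
  by rewrite -powR_mulrn ?(ltW r0)// -powRrM.
have P2 : 0 < 2 `^ q :> R by rewrite powR_gt0.
have P8 : 0 < 8 `^ p :> R by rewrite powR_gt0.
have Pr : 0 < r `^ (3 * p) by rewrite powR_gt0.
have main : W `^ (q + 3) <= M * 2 `^ q * 8 `^ p * 16 ^+ 3 * r `^ (3 * p + 3).
  rewrite h1 h2.
  have -> : W `^ q * W ^+ 3 = K * (w * w * w) *
      (2 `^ q * 8 `^ p * 16 ^+ 3 * (r `^ (3 * p) * r ^+ 3)).
    rewrite /K h3 h4 /w; field.
    by rewrite (gt_eqF P2) (gt_eqF P8) (gt_eqF Pr) (gt_eqF L0) (gt_eqF r0).
  rewrite -!(mulrA M); apply: ler_pM KM _ => //.
  - exact: (mulr_ge0 K0 (mulr_ge0 (mulr_ge0 (ltW w0) (ltW w0)) (ltW w0))).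
  - by rewrite !mulr_ge0 ?powR_ge0 ?exprn_ge0 ?(ltW r0).
have q30 : 0 < q + 3 by rewrite addr_gt0.
have Mc0 : 0 <= M * 2 `^ q * 8 `^ p * 16 ^+ 3.
  by rewrite !mulr_ge0// ltW.
have -> : W = (W `^ (q + 3)) `^ (q + 3)^-1.
  by rewrite -powRrM mulfV ?(gt_eqF q30)// powRr1 ?(ltW W0).
rewrite /flat_const /flat_exponent powRrM -powRM ?powR_ge0//.
by apply: ge0_ler_powR; rewrite ?nnegrE ?powR_ge0 ?invr_ge0 ?(ltW q30)// mulr_ge0 ?powR_ge0.
Qed.

Lemma energy_flat : flat (flat_const p q M) (flat_exponent p q) g.
Proof.
have red u : exists2 v, 0 <= v <= 1 & g u = g v.
  have [m /andP[m0 m1]] := fract_itv u.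
  exists (u - m%:~R); first by rewrite m0 ltW.
  by rewrite -(periodic_int gp u (- m)) rmorphN.
move=> u1 u2 u3 r r0.
have [v1 ? ->] := red u1; have [v2 ? ->] := red u2; have [v3 ? ->] := red u3.
exact: energy_flat_unit.
Qed.

Lemma flat_const_gt0 : 0 < flat_const p q M.
Proof. by rewrite powR_gt0// !mulr_gt0// powR_gt0. Qed.

End energy_flat.

(** Cleared of denominators the claim is [2 * (q + 3) < 3 * p + 3], which is the lower bound on
    [p]. *)
Lemma flat_exponent_gt2 (R : realType) (p q : R) : 1 < q -> 2 / 3 * q + 1 < p ->
  2 < flat_exponent p q.
Proof. by move=> q1 hp; rewrite ltr_pdivlMr; lra. Qed.

(** * Ambient isotopies *)

Lemma homeomorphism_comp (T U W : topologicalType) (f : T -> U) (g : U -> W) :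
  homeomorphism f -> homeomorphism g -> homeomorphism (g \o f).
Proof.
move=> [cf [f' cf' [fK f'K]]] [cg [g' cg' [gK g'K]]]; split.
  by move=> x; apply: continuous_comp; [exact: cf|exact: cg].
exists (f' \o g').
  by move=> x; apply: continuous_comp; [exact: cg'|exact: cf'].
by split; [exact: can_comp|exact: can_comp].
Qed.

(** Completeness of the space, for Banach's fixed point theorem. *)
HB.instance Definition _ (R : realType) (n : nat) := Complete.on 'rV[R]_n.

Section ambient_isotopy.
Context {R : realType} {n : nat}.
Implicit Types g h : R -> 'rV[R]_n.

Lemma ambient_isotopic_refl g : ambient_isotopic g g.
Proof.
exists (fun _ x => x); last by rewrite image_id.
split=> //; last first.
  have ci : continuous (fun x : 'rV[R]_n => x) by move=> x; exact: cvg_id.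
  by move=> t _; split => //; exists id.
by apply: continuous_subspaceT => z; exact: cvg_snd.
Qed.

(** The isotopies are composed at each time instead of being concatenated, which avoids gluing in
    time. *)
Lemma ambient_isotopic_trans (Phi : R -> 'rV[R]_n -> 'rV[R]_n) g0 g h :
  ambient_isotopic g0 g ->
  continuous (fun z : R * 'rV[R]_n => Phi z.1 z.2) ->
  (forall t, t \in `[0, 1] -> homeomorphism (Phi t)) -> Phi 0 = id ->
  (forall u, Phi 1 (g u) = h u) -> ambient_isotopic g0 h.
Proof.
move=> [H [cH hH H0] H1] cPhi hPhi Phi0 gh.
exists (fun t => Phi t \o H t).
  split.
  - move=> z.
    apply: (continuous2_cvg _ (@cPhi (z.1, H z.1 z.2)) _ (@cH z)).
    exact: (continuous_subspaceT (f := fst) (fun x => cvg_fst)).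
  - by move=> t t01; apply: homeomorphism_comp; [exact: hH|exact: hPhi].
  - by rewrite Phi0 H0.
rewrite /= -image_comp H1; apply/seteqP; split.
  by move=> _ [_ [u _ <-] <-]; exists u => //; rewrite gh.
by move=> _ [u _ <-]; exists (g u); [exists u|rewrite gh].
Qed.

(** A solution of [x + t *: V x = y] is a fixed point of the contraction [x |-> y - t *: V x]. The
    map expands distances at least by [1 - k], whence injectivity and a Lipschitz inverse. *)
Lemma homeomorphism_perturbation (V : 'rV[R]_n -> 'rV[R]_n) (k t : R) :
  0 <= k < 1 -> (forall x y, `|V x - V y| <= k * `|x - y|) ->
  0 <= t <= 1 -> homeomorphism (fun x : 'rV[R]_n => x + t *: V x).
Proof.
move=> /andP[k0 k1] Vk /andP[t0 t1].
have tVk x y : `|t *: V x - t *: V y| <= k * `|x - y|.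
  rewrite -scalerBr normrZ (ger0_norm t0) (le_trans _ (Vk x y))//.
  by rewrite ler_piMl.
split.
  apply: (@lipschitz_cts _ _ _ _ (1 + k)) => x y.
  by rewrite opprD addrACA (le_trans (ler_normD _ _))// mulrDl mul1r lerD2l.
have ex y : exists x, x + t *: V x = y.
  pose f x := y - t *: V x.
  have fF : set_fun [set: 'rV[R]_n] setT f by [].
  pose F : {fun [set: 'rV[R]_n] >-> [set: 'rV[R]_n]} := HB.pack f (isFun.Build _ _ _ _ f fF).
  have cF : is_contraction F.
    exists (NngNum k0); split=> //= -[x z] _ /=.
    by rewrite /f opprB addrC subrKA distrC.
  have [|x _ fx] := banach_fixed_point cF closedT; first by exists 0.
  by exists x; rewrite {1}fx; exact: subrK.
pose f' y := sval (cid (ex y)).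
have f'K y : f' y + t *: V (f' y) = y by rewrite /f'; case: cid.
have lip x y : (1 - k) * `|x - y| <= `|(x + t *: V x) - (y + t *: V y)|.
  rewrite opprD addrACA mulrBl mul1r lerBlDr.
  rewrite -[in leLHS](addrK (t *: V x - t *: V y) (x - y)).
  by rewrite (le_trans (ler_normB _ _))// lerD2l.
have k10 : 0 < 1 - k by rewrite subr_gt0.
have inj x y : x + t *: V x = y + t *: V y -> x = y.
  move=> xy; have := lip x y; rewrite xy subrr normr0.
  by rewrite pmulr_rle0// normr_le0 subr_eq0 => /eqP.
exists f'.
  apply: (@lipschitz_cts _ _ _ _ (1 - k)^-1) => x y.
  by rewrite ler_pdivlMl// (le_trans (lip _ _))// !f'K.
by split=> x; [apply: inj; rewrite f'K|rewrite f'K].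
Qed.

(* McShane's extension, coordinatewise and for the sup norm, so that the
   Lipschitz constant is kept. *)
Lemma mcshane_extension (D g : R -> 'rV[R]_n) (k : R) : 0 <= k ->
  (forall u v, `|D u - D v| <= k * `|g u - g v|) ->
  exists2 V : 'rV[R]_n -> 'rV[R]_n,
    forall x y, `|V x - V y| <= k * `|x - y| & forall u, V (g u) = D u.
Proof.
move=> k0 Dk.
(* The extension is the lower envelope of the cones of slope [k] over the points of the curve; the
   hypothesis makes [D u] depend on [g u] only. *)
pose A x i := range (fun u => D u ord0 i + k * `|x - g u|).
have Dki u v i : D u ord0 i - k * `|g u - g v| <= D v ord0 i.
  rewrite lerBlDl -lerBlDr (le_trans _ (Dk u v))//.
  apply: le_trans (normr_coord_le (D u - D v) i).
  have -> : (D u - D v) ord0 i = D u ord0 i - D v ord0 i by rewrite !mxE.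
  exact: ler_norm.
have lbA x i v : lbound (A x i) (D v ord0 i - k * `|x - g v|).
  move=> _ [u _ <-]; rewrite -lerBlDr -addrA -opprD -mulrDr.
  apply: le_trans (Dki v u i); rewrite lerD2l lerN2 ler_wpM2l//.
  by rewrite (distrC x (g v)) ler_distD.
have infA x i : has_inf (A x i).
  split; first by exists (D 0 ord0 i + k * `|x - g 0|); exists 0.
  by exists (D 0 ord0 i - k * `|x - g 0|); exact: lbA.
pose V x : 'rV[R]_n := \row_i inf (A x i).
have Vle x y i : inf (A x i) <= inf (A y i) + k * `|x - y|.
  rewrite -lerBlDr; apply: lb_le_inf; first exact: (infA y i).1.
  move=> _ [u _ <-]; rewrite lerBlDr.
  apply: (@le_trans _ _ (D u ord0 i + k * `|x - g u|)).
    by apply: ge_inf; [exact: (infA x i).2|exists u].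
  rewrite -addrA lerD2l -mulrDr ler_wpM2l// [leRHS]addrC.
  exact: ler_distD.
exists V.
  move=> x y; rewrite [leLHS]/Num.Def.normr/= mx_normrE.
  apply: bigmax_le; first by rewrite mulr_ge0.
  move=> [i j] _ /=; rewrite !mxE ler_norml lerBlDl Vle andbT.
  by rewrite lerNl opprB lerBlDl distrC Vle.
move=> u; apply/rowP => i; rewrite mxE; apply/eqP; rewrite eq_le; apply/andP; split.
  apply: ge_inf; first exact: (infA (g u) i).2.
  by exists u => //; rewrite subrr normr0 mulr0 addr0.
apply: lb_le_inf; first exact: (infA (g u) i).1.
by have := @lbA (g u) i u; rewrite subrr normr0 mulr0 subr0.
Qed.

Lemma ambient_isotopic_perturbation g0 g h (k : R) : ambient_isotopic g0 g ->
  0 <= k < 1 ->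
  (forall u v, `|(h u - g u) - (h v - g v)| <= k * `|g u - g v|) ->
  ambient_isotopic g0 h.
Proof.
move=> g0g k01 hk; have /andP[k0 _] := k01.
have [V Vk Vg] := mcshane_extension k0 hk.
apply: (ambient_isotopic_trans (Phi := fun t x => x + t *: V x)) g0g _ _ _ _.
- move=> z; apply: cvgD; first exact: cvg_snd.
  apply: cvgZ; first exact: cvg_fst.
  apply: (@continuous_comp _ _ _ snd V); first exact: cvg_snd.
  exact: lipschitz_cts Vk _.
- move=> t; rewrite in_itv/=; exact: homeomorphism_perturbation Vk.
- by apply/funext => x; rewrite scale0r addr0.
- by move=> u; rewrite scale1r Vg subrKC.
Qed.

Lemma ambient_isotopic_dilation g0 g (c : R) : ambient_isotopic g0 g -> 0 < c ->
  ambient_isotopic g0 (fun u => c *: g u).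
Proof.
move=> g0g c0; pose s t : R := 1 + t * (c - 1).
have s0 t : t \in `[0, 1] -> 0 < s t.
  rewrite in_itv/= => /andP[t0 t1]; rewrite /s.
  have := mulr_ge0 t0 (ltW c0); have [t10|t10] := eqVneq t 0; nra.
apply: (ambient_isotopic_trans (Phi := fun t x => s t *: x)) g0g _ _ _ _.
- move=> z; apply: cvgZ; last exact: cvg_snd.
  by apply: cvgD; [exact: cvg_cst|apply: cvgM; [exact: cvg_fst|exact: cvg_cst]].
- move=> t /s0 st; split; first exact: scaler_continuous.
  exists (fun x => (s t)^-1 *: x); first exact: scaler_continuous.
  by split=> x; rewrite scalerA ?mulVf ?mulfV ?gt_eqF// scale1r.
- by apply/funext => x; rewrite /s mul0r addr0 scale1r.
- by move=> u; rewrite /s mul1r subrKC.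
Qed.

Lemma ambient_isotopic_range g0 g h : ambient_isotopic g0 g ->
  range g = range h -> ambient_isotopic g0 h.
Proof. by move=> [H iH H1] gh; exists H => //; rewrite H1. Qed.

End ambient_isotopy.

(** * Change of variables *)

Section density.
Context d (T : measurableType d) (R : realType).
Variables (mu : {measure set T -> \bar R}) (w : T -> R).
Hypotheses (mw : measurable_fun setT w) (w0 : forall t, 0 <= w t).

(** The two proofs are arguments so that the measure structure can be attached to the term
    itself. *)
Definition density_measure & measurable_fun setT w & (forall t, 0 <= w t) :=
  fun A : set T => (\int[mu]_(t in A) (w t)%:E)%E.

Local Notation nu := (density_measure mw w0).

Let nu0 : nu set0 = 0%E. Proof. exact: integral_set0. Qed.

Let nu_ge0 A : (0 <= nu A)%E.
Proof. by apply: integral_ge0 => t _; rewrite lee_fin. Qed.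

Let nu_sigma_additive : semi_sigma_additive nu.
Proof.
apply: semi_sigma_additive_nng_induced; first exact/measurable_EFinP.
by move=> t; rewrite lee_fin.
Qed.

HB.instance Definition _ := isMeasure.Build _ _ R nu nu0 nu_ge0 nu_sigma_additive.

Lemma density_measureE A : nu A = (\int[mu]_(t in A) (w t)%:E)%E.
Proof. by []. Qed.

Import HBNNSimple.

(** Monotone convergence along simple functions reduces the claim, by linearity, to indicators,
    where it is the definition of the measure. *)
Lemma integral_density (f : T -> \bar R) : measurable_fun setT f ->
  (forall t, 0 <= f t)%E ->
  (\int[nu]_t f t = \int[mu]_t (f t * (w t)%:E))%E.
Proof.
move=> mf f0; pose h := nnsfun_approx measurableT mf.
have mwE : measurable_fun setT (fun t => (w t)%:E).
  by apply/measurable_EFinP; exact: mw.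
have mh m : measurable_fun setT (h m) by exact: measurable_funP.
have hf t : (EFin \o h ^~ t) @ \oo --> f t by exact: cvg_nnsfun_approx.
have ndh t a b : (a <= b)%N -> ((h a t)%:E <= (h b t)%:E)%E.
  by move=> ab; rewrite lee_fin; exact/lefP/nd_nnsfun_approx.
have -> : (\int[nu]_t f t = limn (fun m => \int[nu]_t (h m t)%:E))%E.
  rewrite -monotone_convergence//.
  - by apply: eq_integral => t _; apply/esym/cvg_lim => //; exact: hf.
  - by move=> m; apply/measurable_EFinP; exact: mh.
  - by move=> m t _; rewrite lee_fin.
  - by move=> t _ a b ab; exact: (ndh t a b ab).
have -> : (\int[mu]_t (f t * (w t)%:E) =
    limn (fun m => \int[mu]_t ((h m t)%:E * (w t)%:E)))%E.
  rewrite -monotone_convergence//.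
  - apply: eq_integral => t _; apply/esym/cvg_lim => //.
    by apply: cvgeZr => //; exact: hf.
  - move=> m; by apply: emeasurable_funM; [apply/measurable_EFinP; exact: mh|exact: mwE].
  - by move=> m t _; rewrite mule_ge0 ?lee_fin.
  - by move=> t _ a b ab; rewrite lee_wpmul2r ?lee_fin//; have := ndh t a b ab; rewrite lee_fin.
congr (limn _); apply/funext => m.
under [LHS]eq_integral => t _ do rewrite fimfunE -fsumEFin//.
rewrite [LHS]ge0_integral_fsum//; last 2 first.
- move=> r; apply/measurable_EFinP; exact: measurable_funM.
- by move=> r t _; exact: nnfun_muleindic_ge0.
under [RHS]eq_integral => t _.
  rewrite fimfunE -fsumEFin// ge0_mule_fsuml; last first.
    by move=> r; exact: nnfun_muleindic_ge0.
  over.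
rewrite ge0_integral_fsum//; last 2 first.
- move=> r; apply: emeasurable_funM mwE.
  exact/measurable_EFinP/measurable_funM.
- by move=> r t _; rewrite mule_ge0 ?nnfun_muleindic_ge0 ?lee_fin.
apply: eq_fsbigr => r; rewrite inE => -[t _ <-].
rewrite integralZl_indic_nnsfun// integral_indic// setIT.
under [RHS]eq_integral => u _ do rewrite EFinM -muleA.
rewrite ge0_integralZl//.
- congr (_ * _)%E; rewrite [LHS]density_measureE integral_mkcond.
  by apply: eq_integral => u _; rewrite epatch_indic muleC.
- by apply: emeasurable_funM mwE; exact/measurable_EFinP.
- by move=> u _; rewrite mule_ge0 ?lee_fin.
- by rewrite lee_fin.
Qed.

End density.

(** * Substitution in one variable *)

Section substitution.
Context {R : realType}.
Local Notation mu := (@lebesgue_measure R).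
Variables (s r w : R -> R).
Hypotheses (rK : cancel r s) (s_incr : {homo s : x y / x < y}).
Hypotheses (ds : forall t : R, is_derive t 1 s (w t)) (cw : continuous w).
Hypothesis w0 : forall t, 0 <= w t.

Let mw : measurable_fun setT w. Proof. exact: continuous_measurable_fun. Qed.

Let cs : continuous s.
Proof.
move=> t; apply: differentiable_continuous; apply/derivable1_diffP.
by have [] := ds t.
Qed.

Let ms : measurable_fun setT (s : measurableTypeR R -> measurableTypeR R).
Proof. exact: continuous_measurable_fun. Qed.

Let S : {mfun measurableTypeR R >-> measurableTypeR R} :=
  HB.pack (s : measurableTypeR R -> measurableTypeR R) (isMeasurableFun.Build _ _ _ _ _ ms).

Let s_mono x y : (s x < s y) = (x < y).
Proof.
apply/idP/idP; last exact: s_incr.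
have [//|yx] := ltP x y; move: yx; rewrite le_eqVlt => /orP[/eqP->|/s_incr]; lra.
Qed.

(** Lebesgue measure is determined by half-open intervals. The preimage of []a, b]] under the
    increasing [s] is []r a, r b]], of weight [s (r b) - s (r a) = b - a]. *)
Lemma pushforward_density A : measurable A ->
  mu A = pushforward (density_measure mu mw w0) S A.
Proof.
apply: (lebesgue_measure_unique (mu := pushforward (density_measure mu mw w0) S)).
move=> _ [[a b] /= ab <-].
rewrite /pushforward lebesgue_measure_itv/= lte_fin.
have -> : S @^-1` `]a, b] = `]r a, r b]%classic.
  have e t : (t \in `]r a, r b]) = (s t \in `]a, b]).
    by rewrite !in_itv/= -{2}(rK a) -{2}(rK b) s_mono (leNgt (s t)) s_mono -leNgt.
  by apply/seteqP; split => t /=; rewrite e.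
rewrite density_measureE; case: ltP => [ab'|ba]; last first.
  by rewrite set_itv_ge ?integral_set0// bnd_simp -s_mono !rK -leNgt.
rewrite integral_itv_obnd_cbnd; last first.
  by apply/measurable_EFinP; exact: measurable_funTS.
rewrite (continuous_FTC2 (F := s)).
- by rewrite !rK.
- by rewrite -s_mono !rK.
- exact: continuous_subspaceT.
- split=> [t _||].
  + by have [] := ds t.
  + exact/cvg_at_right_filter/cs.
  + exact/cvg_at_left_filter/cs.
- by move=> t _; rewrite derive1E; have [_ ->] := ds t.
Qed.

Lemma integral_substitution (f : R -> \bar R) : measurable_fun setT f ->
  (forall t, 0 <= f t)%E ->
  (\int[mu]_t f t = \int[mu]_t (f (s t) * (w t)%:E))%E.
Proof.
move=> mf f0.
rewrite -(integral_density mu mw w0); last 2 first.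
- exact: (measurableT_comp mf ms).
- by [].
transitivity (\int[pushforward (density_measure mu mw w0) S]_t f t)%E.
  by apply: eq_measure_integral => A mA _; exact: pushforward_density.
by rewrite (ge0_integral_pushforward ms).
Qed.

End substitution.

(** Stated for nonnegative functions on the whole space, so that Tonelli's theorem carries it to
    products. *)
Definition change_of_variable d (T : measurableType d) (R : realType)
    (mu : {measure set T -> \bar R}) (s : T -> T) (w : T -> R) : Prop :=
  forall f : T -> \bar R, measurable_fun setT f -> (forall t, 0 <= f t)%E ->
  (\int[mu]_t f t = \int[mu]_t (f (s t) * (w t)%:E))%E.

Lemma change_of_variable_prod d1 d2 (T1 : measurableType d1)
    (T2 : measurableType d2) (R : realType)
    (m1 : {sigma_finite_measure set T1 -> \bar R})
    (m2 : {sigma_finite_measure set T2 -> \bar R})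
    (s1 : T1 -> T1) (s2 : T2 -> T2) (w1 : T1 -> R) (w2 : T2 -> R) :
  measurable_fun setT s1 -> measurable_fun setT s2 ->
  measurable_fun setT w1 -> measurable_fun setT w2 ->
  (forall x, 0 <= w1 x) -> (forall y, 0 <= w2 y) ->
  change_of_variable m1 s1 w1 -> change_of_variable m2 s2 w2 ->
  change_of_variable (m1 \x m2)%E (fun u => (s1 u.1, s2 u.2))
    (fun u => w1 u.1 * w2 u.2).
Proof.
move=> ms1 ms2 mw1 mw2 w10 w20 h1 h2 f mf f0.
have mfs : measurable_fun setT (fun u : T1 * T2 => f (s1 u.1, s2 u.2)).
  apply: (measurableT_comp mf); apply/measurable_fun_pairP; split.
    by apply: (measurableT_comp ms1); exact: measurable_fst.
  by apply: (measurableT_comp ms2); exact: measurable_snd.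
have mww : measurable_fun setT (fun u : T1 * T2 => (w1 u.1 * w2 u.2)%:E).
  apply/measurable_EFinP; apply: measurable_funM.
    by apply: (measurableT_comp mw1); exact: measurable_fst.
  by apply: (measurableT_comp mw2); exact: measurable_snd.
rewrite fubini_tonelli1// [RHS]fubini_tonelli1//; last 2 first.
- exact: emeasurable_funM.
- by move=> u; rewrite mule_ge0// lee_fin mulr_ge0.
rewrite h1; last 2 first.
- exact: measurable_fun_fubini_tonelli_F.
- by move=> x; exact: integral_ge0.
apply: eq_integral => x _; rewrite /fubini_F/=.
rewrite h2//; last exact: measurable_fun_pair2.
rewrite -ge0_integralZr//.
- by apply: eq_integral => y _; rewrite -muleA -EFinM (mulrC (w2 y)).
- apply: emeasurable_funM; last exact/measurable_EFinP.
  exact: (measurable_fun_pair2 x mfs).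
- by move=> y _; rewrite mule_ge0// lee_fin.
- by rewrite lee_fin.
Qed.

(** The integrals from [- N] to [t], normalized at 0, are primitives to the right of [- N]. Two of
    them agree where both are defined, their difference having derivative 0, so they glue to a
    primitive on the line. *)
Lemma continuous_primitive (R : realType) (f : R -> R) : continuous f ->
  exists F : R -> R, forall t : R, is_derive t 1 F (f t).
Proof.
move=> cf.
pose A (N : nat) (t : R) := Rintegral (@lebesgue_measure R) `[- N%:R, t] f.
have dA (N : nat) (t : R) : - N%:R < t -> is_derive t 1 (A N) (f t).
  move=> Nt; have tt1 : t < t + 1 by rewrite ltrDl.
  have [|d1 d2] := @continuous_FTC1_closed R f (- N%:R) t (t + 1) tt1 _ Nt (cf t).
    apply: continuous_compact_integrable; first exact: segment_compact.
    exact: continuous_subspaceT.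
  by split; [exact: d1|rewrite -derive1E; exact: d2].
pose B N t := A N t - A N 0.
have dB (N : nat) (t : R) : - N%:R < t -> is_derive t 1 (B N) (f t).
  move=> /dA dAN; rewrite /B.
  by apply: is_derive_eq; rewrite subr0.
have BB (N M : nat) (t : R) : (0 < N)%N -> (0 < M)%N -> - N%:R < t -> - M%:R < t ->
    B N t = B M t.
  move=> N0 M0 Nt Mt; pose D u := B N u - B M u.
  have dD u : Num.min 0 t <= u -> is_derive u 1 D 0.
    move=> tu.
    have mu (m : nat) : (0 < m)%N -> - m%:R < t -> - m%:R < u.
      by move=> m0 mt; rewrite (lt_le_trans _ tu)// lt_min mt andbT oppr_lt0 ltr0n.
    have d1 := dB N u (mu N N0 Nt); have d2 := dB M u (mu M M0 Mt).
    by apply: is_derive_eq; rewrite subrr.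
  have D0 : D 0 = 0 by rewrite /D /B !subrr.
  have cD a b : Num.min 0 t <= a -> {within `[a, b], continuous D}.
    move=> ta; apply: derivable_within_continuous => u.
    by rewrite in_itv/= => /andP[au _]; have [] := dD u (le_trans ta au).
  have : D t = 0.
    have [t0|/ltW t0] := leP 0 t.
      have := @MVT_segment R D (fun=> 0) 0 t t0 _ (cD _ _ _).
      case=> [u||c _]; last by rewrite D0 subr0 mul0r.
        by rewrite in_itv/= => /andP[u0 _]; apply: dD; rewrite ge_min (ltW u0).
      by rewrite ge_min lexx.
    have := @MVT_segment R D (fun=> 0) t 0 t0 _ (cD _ _ _).
    case=> [u||c _]; last by rewrite D0 sub0r mul0r => /eqP; rewrite oppr_eq0 => /eqP.
      by rewrite in_itv/= => /andP[u0 _]; apply: dD; rewrite ge_min (ltW u0) orbT.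
    by rewrite ge_min lexx orbT.
  by move=> /eqP; rewrite subr_eq0 => /eqP.
pose N (t : R) := (Num.bound `|t|).+1.
have Nt (t : R) : - (N t)%:R < t.
  rewrite ltrNl (le_lt_trans (ler_norm _))// normrN.
  by rewrite (lt_le_trans (archi_boundP _))// ler_nat.
exists (fun t => B (N t) t) => t.
(* Near [t] all the glued pieces coincide with the single function [B M]. *)
pose M := (N t).+1.
have Mt : - M%:R < t by rewrite (lt_trans _ (Nt t))// ltrN2 ltr_nat.
apply: (near_eq_is_derive (f := B M)); last exact: dB.
near=> u; apply: BB => //; near: u.
exact: lt_nbhsr.
Unshelve. all: by end_near. Qed.

(** * Reparametrization by constant speed *)

(** A violation would persist on an open interval, of positive measure. Thus the speed of a regular
    [C^1] curve is bounded below at every parameter. *)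
Lemma ae_ge_continuous (R : realType) (f : R -> R) (c : R) : continuous f ->
  {ae (@lebesgue_measure R), forall t, c <= f t} -> forall t, c <= f t.
Proof.
move=> cf [N [mN N0 fN]] t; rewrite leNgt; apply/negP => ftc.
have : \forall u \near t, f u < c.
  have := cf t; move=> /(_ [set y | y < c]); apply.
  exact: lt_nbhsl.
move=> /nbhs_ballP[r /= r0 hr].
have sub : `](t - r), (t + r)[ `<=` N.
  move=> u; rewrite /= in_itv/= => /andP[u1 u2]; apply: fN => /=.
  have : f u < c by apply: hr; rewrite /ball/= ltr_distlC u1 u2.
  by rewrite ltNge => /negP.
have : (lebesgue_measure (`](t - r)%R, (t + r)%R[%classic : set R) <= 0)%E.
  by rewrite -N0; apply: le_measure; rewrite ?inE//; exact: measurable_itv.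
rewrite lebesgue_measure_itv/= lte_fin ifT; last by rewrite ltrBlDr -addrA ltrDl addr_gt0.
rewrite -EFinB lee_fin; lra.
Qed.

Lemma is_derive_row (R : realType) (n : nat) (g : R -> 'rV[R]_n) (t : R) (v : 'rV[R]_n) :
  (forall i, is_derive t 1 (fun u => g u ord0 i) (v ord0 i)) -> is_derive t 1 g v.
Proof.
move=> dg.
have d : derivable g t 1.
  by apply/derivable_mxP => i j; rewrite ord1; have [] := dg j.
split=> //; rewrite derive_mx//; apply/rowP => j; rewrite mxE.
by have [_ ->] := dg j.
Qed.

Lemma is_derive_coord (R : realType) (n : nat) (g : R -> 'rV[R]_n) (t : R) i :
  derivable g t 1 ->
  is_derive t 1 (fun u => g u ord0 i) (derive1 g t ord0 i).
Proof.
move=> dg; split; first by move/derivable_mxP: dg; apply.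
by rewrite derive1E derive_mx// mxE.
Qed.

Lemma is_derive_comp_curve (R : realType) (n : nat) (g : R -> 'rV[R]_n) (r : R -> R)
    (t a : R) :
  derivable g (r t) 1 -> is_derive t 1 r a ->
  is_derive t 1 (g \o r) (a *: derive1 g (r t)).
Proof.
move=> dg dr; apply: is_derive_row => i; rewrite mxE mulrC.
exact: (@is_derive1_comp _ (fun u => g u ord0 i)) (is_derive_coord i dg) dr.
Qed.

Lemma continuous_speed (R : realType) (n : nat) (g : R -> 'rV[R]_n) :
  continuous (derive1 g) -> continuous (fun t => enorm (derive1 g t)).
Proof.
move=> cg t; apply: (@continuous_comp _ _ _ (derive1 g) (@enorm R n)).
  exact: cg.
exact: enorm_continuous.
Qed.

Section reparametrization.
Context {R : realType}.
Variables (w : R -> R).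
Hypotheses (cw : continuous w) (w0 : forall t, 0 < w t).
Variable s : R -> R.
Hypotheses (ds : forall t : R, is_derive t 1 s (w t)) (s0 : s 0 = 0).
Hypothesis sp : forall t, s (t + 1) = s t + 1.

Lemma derive_continuous : continuous s.
Proof.
move=> t; apply: differentiable_continuous; apply/derivable1_diffP.
by have [] := ds t.
Qed.

Lemma derive_gt0_homo : {homo s : x y / x < y}.
Proof.
move=> x y xy.
have [c _ h] := MVT_segment (ltW xy) (fun t _ => ds t) (continuous_subspaceT derive_continuous).
by rewrite -subr_gt0 h mulr_gt0// subr_gt0.
Qed.

Lemma quasiperiodic_int (k : int) : s k%:~R = k%:~R.
Proof.
have := periodic_int (f := fun t => s t - t).
move=> /(_ _ 0 k); rewrite add0r s0 subr0 => h.
by apply/eqP; rewrite -subr_eq0 h// => t; rewrite sp opprD addrACA subrr addr0.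
Qed.

(** [s] is strictly increasing and fixes the integers, so the intermediate value theorem between
    consecutive integers gives surjectivity. *)
Lemma quasiperiodic_inverse : exists r : R -> R, [/\ cancel s r, cancel r s,
  forall y : R, is_derive y 1 r (w (r y))^-1 & forall y, r (y + 1) = r y + 1].
Proof.
have inj x y : s x = s y -> x = y.
  move=> sxy; have [xy|xy|//] := ltgtP x y.
    by have := derive_gt0_homo xy; rewrite sxy ltxx.
  by have := derive_gt0_homo xy; rewrite sxy ltxx.
have surj y : exists x, s x = y.
  have [k /andP[k0 k1]] := fract_itv y.
  have kk : k%:~R <= k%:~R + 1 :> R by rewrite lerDl.
  have [||x _ <-] := @IVT R s k%:~R (k%:~R + 1) y kk; last by exists x.
    by apply: continuous_subspaceT; exact: derive_continuous.
  rewrite sp quasiperiodic_int (min_idPl kk) (max_idPr kk).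
  by apply/andP; split; lra.
pose r y := sval (cid (surj y)).
have rK : cancel r s by move=> y; rewrite /r; case: cid.
have sK : cancel s r by move=> x; apply: inj; rewrite rK.
exists r; split => //.
  move=> y; rewrite -{1}(rK y); apply: (is_derive_inverse _ _ (ds (r y))).
  - by near=> u; exact: sK.
  - by near=> u; exact: derive_continuous.
  - by rewrite gt_eqF.
by move=> y; apply: inj; rewrite rK sp rK.
Unshelve. all: by end_near. Qed.

End reparametrization.

Lemma intM_density_comp (R : realType) (n : nat) (p q : R)
    (g h : R -> 'rV[R]_n) (s w : R -> R) (u1 u2 u3 : R) :
  (forall t, h (s t) = g t) ->
  (forall t, enorm (derive1 h (s t)) * w t = enorm (derive1 g t)) ->
  intM_density p q h (s u1) (s u2) (s u3) * (w u1 * w u2 * w u3) =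
  intM_density p q g u1 u2 u3.
Proof.
move=> hs hw; rewrite /intM_density !hs -(hw u1) -(hw u2) -(hw u3) -mulrA.
congr (_ * _).
move: (enorm _) (enorm _) (enorm _) => x y z; ring.
Qed.

(** The integrands are extended by 0 outside [D], and [s] maps neither into nor out of [D]. *)
Lemma change_of_variable_in d (T : measurableType d) (R : realType)
    (mu : {measure set T -> \bar R}) (s : T -> T) (w : T -> R) (D : set T)
    (f f' : T -> \bar R) :
  change_of_variable mu s w -> measurable D ->
  measurable_fun setT f -> (forall t, 0 <= f t)%E ->
  (forall t, D (s t) <-> D t) -> (forall t, (f (s t) * (w t)%:E)%E = f' t) ->
  (\int[mu]_(t in D) f t = \int[mu]_(t in D) f' t)%E.
Proof.
move=> cov mD mf f0 sD ff'; rewrite integral_mkcond cov; last 2 first.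
- by apply/(measurable_restrictT _ mD); exact: measurable_funTS.
- by move=> t; apply: erestrict_ge0.
rewrite [RHS]integral_mkcond; apply: eq_integral => t _; rewrite !patchE.
have -> : (s t \in D) = (t \in D) by apply/idP/idP; rewrite !inE => /sD.
by case: ifP => _; [exact: ff'|rewrite mul0e].
Qed.

(** Products of exhausting sets exhaust the product. This lets the square of Lebesgue measure be a
    factor of the triple product. *)
Lemma sigma_finite_product d1 d2 (T1 : measurableType d1)
    (T2 : measurableType d2) (R : realType)
    (m1 : {sigma_finite_measure set T1 -> \bar R})
    (m2 : {sigma_finite_measure set T2 -> \bar R}) :
  sigma_finite setT (m1 \x m2)%E.
Proof.
have /sigma_finiteP[F [TF ndF Foo]] := sigma_finiteT m1.
have /sigma_finiteP[G [TG ndG Goo]] := sigma_finiteT m2.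
exists (fun k => F k `*` G k).
  apply/seteqP; split=> // -[x y] _.
  have [i _ Fx] : (\bigcup_i F i) x by rewrite -TF.
  have [j _ Gy] : (\bigcup_i G i) y by rewrite -TG.
  exists (maxn i j) => //; split.
    by move: x Fx; apply/subsetPset/ndF; rewrite leq_maxl.
  by move: y Gy; apply/subsetPset/ndG; rewrite leq_maxr.
move=> k; have [mF Fk] := Foo k; have [mG Gk] := Goo k.
split; first exact: measurableX.
by rewrite product_measure1E// lte_mul_pinfty// ge0_fin_numE.
Qed.

(** * Invariance of the energy under reparametrization *)

Section intM_reparametrization.
Context {R : realType} {n : nat}.
Local Notation mu := (@lebesgue_measure R).
Variables (s r w : R -> R).
Hypotheses (rK : cancel r s) (s_homo : {homo s : x y / x < y}).
Hypotheses (ds : forall t : R, is_derive t 1 s (w t)) (cw : continuous w).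
Hypotheses (w0 : forall t, 0 <= w t) (s0 : s 0 = 0) (s1 : s 1 = 1).

Local Notation T := (measurableTypeR R).

Let unit_itv t : (s t \in `[0, 1]) = (t \in `[0, 1]).
Proof.
have mono x y : (s x <= s y) = (x <= y).
  by rewrite (@le_mono _ _ _ _ s)//; move=> a b /s_homo.
by rewrite !in_itv/= -{1}s0 -{1}s1 !mono.
Qed.

Lemma intM_reparametrization (p q : R) (g h : R -> 'rV[R]_n) : curve_C1 h ->
  (forall t, h (s t) = g t) ->
  (forall t, enorm (derive1 h (s t)) * w t = enorm (derive1 g t)) ->
  intM p q h = intM p q g.
Proof.
move=> hC1 hs hw.
pose sT : T -> T := s; pose wT : T -> R := w.
pose s2 (u : T * T) := (sT u.1, sT u.2); pose w2 (u : T * T) := wT u.1 * wT u.2.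
have ms : measurable_fun setT sT.
  apply: continuous_measurable_fun => t; apply: differentiable_continuous.
  by apply/derivable1_diffP; have [] := ds t.
have mw : measurable_fun setT wT by exact: continuous_measurable_fun.
have cov1 : change_of_variable (mu : {sigma_finite_measure set T -> \bar R}) sT wT.
  move=> f mf f0; exact: (integral_substitution rK s_homo ds cw w0 mf f0).
pose mu2 : {sigma_finite_measure set (T * T)%type -> \bar R} :=
  HB.pack (mu \x mu)%E (Measure_isSigmaFinite.Build _ _ _ (mu \x mu)%E
    (sigma_finite_product mu mu)).
have cov2 : change_of_variable mu2 s2 w2.
  exact: (change_of_variable_prod ms ms mw mw w0 w0 cov1 cov1).
have ms2 : measurable_fun setT s2.
  apply: measurable_fun_pair; first by apply: (measurableT_comp ms); exact: measurable_fst.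
  by apply: (measurableT_comp ms); exact: measurable_snd.
have mw2 : measurable_fun setT w2.
  apply: measurable_funM; first by apply: (measurableT_comp mw); exact: measurable_fst.
  by apply: (measurableT_comp mw); exact: measurable_snd.
have w20 u : 0 <= w2 u by rewrite mulr_ge0.
have cov3 := @change_of_variable_prod _ _ _ _ R mu2 mu s2 sT w2 wT ms2 ms mw2 mw w20 w0 cov2 cov1.
have mcube : measurable ((`[0%R, 1%R] `*` `[0%R, 1%R]) `*` `[0%R, 1%R] :
    set (T * T * T)%type).
  by apply: measurableX; [apply: measurableX|]; exact: measurable_itv.
apply: (change_of_variable_in cov3 mcube).
- by apply/measurable_EFinP; exact: measurable_intM_density.
- by move=> u; rewrite lee_fin intM_density_ge0.
- move=> [[u1 u2] u3] /=; rewrite /s2/= /sT.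
  split=> -[[]] /=; first by rewrite !unit_itv.
  by rewrite -(unit_itv u1) -(unit_itv u2) -(unit_itv u3).
- move=> [[u1 u2] u3]; rewrite -EFinM; apply: (congr1 EFin).
  exact: intM_density_comp.
Qed.

End intM_reparametrization.

Section constant_speed.
Context {R : realType} {n : nat}.
Local Notation mu := (@lebesgue_measure R).

(** [s] is arc length divided by the total length [l], and [h] is [g] composed with the inverse of
    [s]. *)
Lemma constant_speed_reparametrization (g : R -> 'rV[R]_n) : knot_curve g ->
  exists l h, [/\ 0 < l, knot_curve h, range h = range g,
    forall u, enorm (derive1 h u) = l &
    curve_length g = l%:E /\ forall p q, intM p q h = intM p q g].
Proof.
move=> [gp gC1 ginj [c c0 greg]]; have [dg cg] := gC1.
pose W t := enorm (derive1 g t).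
have cW : continuous W by exact: continuous_speed.
have W0 t : 0 < W t by rewrite (lt_le_trans c0)// (ae_ge_continuous cW greg).
have [F dF] := continuous_primitive cW.
pose l := F 1 - F 0.
have Fp t : F (t + 1) = F t + l.
  (* The increment of [F] over a period is constant, the speed being periodic. *)
  pose D u := F (u + 1) - F u.
  have dD (u : R) : is_derive u 1 D 0.
    have d0 : is_derive u 1 (fun u : R => u + 1) (1 : R).
      by apply: is_derive_eq; rewrite addr0.
    have d1 := @is_derive1_comp R F (fun u => u + 1) u _ _ (dF (u + 1)) d0.
    have d2 := dF u.
    have -> : D = (F \o (fun u => u + 1)) - F by [].
    by apply: is_derive_eq; rewrite mulr1 /W derive1_periodic// subrr.
  have := is_derive_0_is_cst t 0 dD; rewrite /D add0r /l => <-.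
  by rewrite subrKC.
have cF : continuous F by exact: (derive_continuous dF).
have l0 : 0 < l.
  have := derive_gt0_homo W0 dF (ltr01 : 0 < 1 :> R).
  by rewrite subr_gt0.
pose s t := l^-1 * (F t - F 0); pose w t := l^-1 * W t.
have ds (t : R) : is_derive t 1 s (w t).
  have := dF t => dFt; rewrite /s /w.
  apply: is_derive_eq; rewrite /GRing.scale/= subr0 ?mulr0 ?addr0//.
have s0 : s 0 = 0 by rewrite /s subrr mulr0.
have sp t : s (t + 1) = s t + 1.
  by rewrite /s Fp addrAC mulrDr mulVf// gt_eqF.
have s1 : s 1 = 1 by rewrite -{1}(add0r 1) sp s0 add0r.
have w0 t : 0 < w t by rewrite mulr_gt0// invr_gt0.
have cw : continuous w by move=> t; apply: cvgM; [exact: cvg_cst|exact: cW].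
have [r [sK rK dr rp]] := quasiperiodic_inverse w0 ds s0 sp.
have s_homo := derive_gt0_homo w0 ds.
pose h := g \o r.
have dh (y : R) : is_derive y 1 h ((w (r y))^-1 *: derive1 g (r y)).
  exact: is_derive_comp_curve.
have h'E y : derive1 h y = (w (r y))^-1 *: derive1 g (r y).
  by rewrite derive1E; have [_ ->] := dh y.
have cr : continuous r by exact: derive_continuous dr.
have hl u : enorm (derive1 h u) = l.
  rewrite h'E enormZ gtr0_norm ?invr_gt0// /w invfM invrK -mulrA mulVf ?mulr1//.
  by rewrite gt_eqF//; exact: W0.
have hC1 : curve_C1 h.
  split; first by move=> t; have [] := dh t.
  have -> : derive1 h = fun y => (w (r y))^-1 *: derive1 g (r y).
    by apply/funext.
  move=> y; apply: cvgZ.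
    apply: cvgV; first by rewrite gt_eqF.
    by apply: (@continuous_comp _ _ _ r w); [exact: cr|exact: cw].
  by apply: (@continuous_comp _ _ _ r (derive1 g)); [exact: cr|exact: cg].
exists l, h; split.
- exact: l0.
- split.
  + by move=> t; rewrite /h/= rp gp.
  + exact: hC1.
  + have rin x : x \in `[0, 1[ -> r x \in `[0, 1[.
      rewrite !in_itv/= => /andP[x0 x1]; apply/andP; split.
        by rewrite leNgt; apply/negP => /s_homo; rewrite rK s0 ltNge x0.
      by rewrite ltNge le_eqVlt; apply/negP => /orP[/eqP e|/s_homo];
        [move: x1; rewrite -(rK x) -e s1 ltxx|rewrite rK s1 ltNge (ltW x1)].
    move=> x y xin yin hxy; rewrite -(rK x) -(rK y); congr s.
    by apply: ginj hxy; exact: rin.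
  + exists l; first exact: l0.
    by apply: aeW => t; rewrite hl.
- apply/seteqP; split => _ [t _ <-]; first by exists (r t).
  by exists (s t) => //; rewrite /h/= sK.
- exact: hl.
- split.
    rewrite /curve_length (continuous_FTC2 (F := F))//.
    + exact: continuous_subspaceT.
    + split=> [t _||].
      * by have [] := dF t.
      * exact/cvg_at_right_filter/cF.
      * exact/cvg_at_left_filter/cF.
    + by move=> t _; rewrite derive1E; have [_ ->] := dF t.
  move=> p q; apply: (intM_reparametrization rK s_homo ds cw _ s0 s1).
  + by move=> t; exact: ltW.
  + exact: hC1.
  + by move=> t; rewrite /h/= sK.
  + by move=> t; rewrite hl /w mulVKf// gt_eqF.
Qed.

End constant_speed.

(** * Compactness *)

(** In a compact set an ultrafilter has a cluster point, which is then its limit. One ultrafilter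
    serves all parameters at once, in place of a diagonal extraction. *)
Lemma ultra_bounded_cvg (R : realType) (n : nat) (U : set_system nat)
    (v : nat -> 'rV[R]_n) (B : R) : UltraFilter U -> (forall k, enorm (v k) <= B) ->
  exists a : 'rV[R]_n, v k @[k --> U] --> a.
Proof.
move=> UU vB; have PU : ProperFilter U by exact: ultra_proper.
have cB : compact [set a : 'rV[R]_n | `|a| <= B].
  apply: bounded_closed_compact.
    by exists B; split; [exact: num_real|move=> x Bx a /= /le_trans; apply; exact: ltW].
  apply: (@closed_comp _ _ (fun a : 'rV[R]_n => `|a|) [set x | x <= B]).
    by move=> a _; exact: norm_continuous.
  exact: closed_le.
have vB' k : `|v k| <= B by exact: (le_trans (normr_le_enorm _) (vB k)).
have UB : U (v @^-1` [set a : 'rV[R]_n | `|a| <= B]).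
  by apply: filterS (@filterT _ U _) => k _; exact: vB'.
have [a [_ clu]] := cB (v k @[k --> U]) _ UB.
exists a => A aA; rewrite /= /nbhs/=.
have [//|UA] := in_ultra_setVsetC (v @^-1` A) UU.
have [x [Ax nAx]] := clu (~` A) A UA aA.
by [].
Qed.

Lemma enorm_lim_le (R : realType) (n : nat) (T : Type) (F : set_system T)
    (FF : ProperFilter F) (f : T -> 'rV[R]_n) (a : 'rV[R]_n) (b : R) :
  f x @[x --> F] --> a -> (forall x, enorm (f x) <= b) -> enorm a <= b.
Proof.
move=> /cvg_enormP fa fb; apply/ler_addgt0Pr => e e0.
have /filter_ex[x hx] := fa e e0.
have := enorm_dist_le a (f x); rewrite enormBC; have := fb x; lra.
Qed.

Lemma enorm_lim_ge (R : realType) (n : nat) (T : Type) (F : set_system T)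
    (FF : ProperFilter F) (f : T -> 'rV[R]_n) (a : 'rV[R]_n) (b : R) :
  f x @[x --> F] --> a -> (forall x, b <= enorm (f x)) -> b <= enorm a.
Proof.
move=> /cvg_enormP fa fb; apply/ler_addgt0Pr => e e0.
have /filter_ex[x hx] := fa e e0.
have := enorm_dist_le (f x) a; have := fb x; lra.
Qed.

Section limit_curve.
Context {R : realType} {n : nat}.
Variables (L b d0 H k : R) (x : nat -> R -> 'rV[R]_n).
Hypotheses (L0 : 0 < L) (b0 : 0 < b) (d00 : 0 < d0) (H0 : 0 < H) (k0 : 0 < k).
Hypothesis xp : forall j, closed_curve (x j).
Hypothesis dx : forall j t, derivable (x j) t 1.
Hypothesis xL : forall j u, enorm (derive1 (x j) u) = L.
Hypothesis x0 : forall j, x j 0 = 0.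
Hypothesis xH : forall j s t, `|s - t| <= d0 ->
  enorm (derive1 (x j) s - derive1 (x j) t) <= H * (L * `|s - t|) `^ k.
Hypothesis xb : forall j s t, `|s - t| <= 2^-1 ->
  b * `|s - t| <= enorm (x j s - x j t).

Lemma holder_small (e : R) : 0 < e -> exists2 d, 0 < d <= d0 &
  forall r, 0 <= r <= d -> H * (L * r) `^ k <= e.
Proof.
move=> e0; exists (Num.min d0 ((e / H) `^ k^-1 / L)).
  by rewrite lt_min d00 divr_gt0 ?powR_gt0 ?divr_gt0//= ge_min lexx.
move=> r /andP[r0]; rewrite le_min ler_pdivlMr// => /andP[_ rL].
rewrite mulrC -ler_pdivlMr//.
have -> : e / H = ((e / H) `^ k^-1) `^ k.
  by rewrite -powRrM mulVf ?(gt_eqF k0)// powRr1// ltW// divr_gt0.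
apply: ge0_ler_powR; rewrite ?nnegrE ?powR_ge0 ?(ltW k0)//.
  by rewrite mulr_ge0// ltW.
by rewrite mulrC.
Qed.

Section limits.
Variables (U : set_system nat) (UU : UltraFilter U).
Variables (g f : R -> 'rV[R]_n).
Hypothesis xg : forall t, x j t @[j --> U] --> g t.
Hypothesis xf : forall t, derive1 (x j) t @[j --> U] --> f t.

Let PU : ProperFilter U. Proof. exact: ultra_proper. Qed.

Lemma limit_holder s t : `|s - t| <= d0 ->
  enorm (f s - f t) <= H * (L * `|s - t|) `^ k.
Proof.
move=> st.
apply: (enorm_lim_le PU (f := fun j => derive1 (x j) s - derive1 (x j) t)).
  by apply: cvgB; exact: xf.
by move=> j; exact: xH.
Qed.

(** The Hölder bound controls the difference quotients of all [x j] uniformly, so the estimate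
    passes to the limit in [j] before [h] tends to 0. *)
Lemma limit_is_derive (t : R) : is_derive t 1 g (f t).
Proof.
have h : h^-1 *: (g (h *: 1 + t) - g t) @[h --> 0^'] --> f t.
  apply/cvg_enormP => e e0; have [d /andP[d1 d2] hd] := holder_small e0.
  near=> h.
  have h0 : h != 0 by near: h; exact: nbhs_dnbhs_neq.
  have hhd : `|h| <= d.
    by near: h; apply: dnbhs0_le.
  have -> : h^-1 *: (g (h *: 1 + t) - g t) - f t =
      h^-1 *: (g (t + h) - g t - h *: f t).
    by rewrite [RHS]scalerBr scalerA mulVf// scale1r /GRing.scale/= mulr1 (addrC h).
  rewrite enormZ normfV mulrC ler_pdivrMr ?normr_gt0//.
  apply: (enorm_lim_le PU (f := fun j => x j (t + h) - x j t - h *: derive1 (x j) t)).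
    by apply: cvgB; [apply: cvgB; exact: xg|apply: cvgZ; [exact: cvg_cst|exact: xf]].
  move=> j; have hh : h = t + h - t by rewrite addrAC subrr add0r.
  rewrite {2 3}hh; apply: curve_mvt_le => [u|xi]; first exact: dx.
  rewrite -hh => xih; apply: le_trans (xH _ _) _.
    exact: (le_trans xih (le_trans hhd d2)).
  by apply: hd; rewrite normr_ge0/= (le_trans xih).
split; last exact/cvg_lim.
by apply/cvg_ex; exists (f t).
Unshelve. all: by end_near. Qed.

Lemma limit_derive1 : derive1 g = f.
Proof.
by apply/funext => t; rewrite derive1E; have [_ ->] := limit_is_derive t.
Qed.

Lemma limit_knot_curve : knot_curve g.
Proof.
have gp : closed_curve g.
  move=> t; apply/eqP; rewrite -subr_eq0 -enorm_eq0 eq_le enorm_ge0 andbT.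
  apply: (enorm_lim_le PU (f := fun j => x j (t + 1) - x j t)).
    by apply: cvgB; exact: xg.
  by move=> j; rewrite xp subrr enorm0.
have fL t : enorm (f t) = L.
  apply/le_anti/andP; split.
    by apply: (enorm_lim_le PU (@xf t)) => j; rewrite xL.
  by apply: (enorm_lim_ge PU (@xf t)) => j; rewrite xL.
have gb s t : `|s - t| <= 2^-1 -> b * `|s - t| <= enorm (g s - g t).
  move=> st; apply: (enorm_lim_ge PU (f := fun j => x j s - x j t)).
    by apply: cvgB; exact: xg.
  by move=> j; exact: xb.
have sep s t : `|s - t| <= 2^-1 -> g s = g t -> s = t.
  move=> st gst; have := gb s t st; rewrite gst subrr enorm0.
  by rewrite pmulr_rle0// normr_le0 subr_eq0 => /eqP.
split => //.
- split; first by move=> t; have [] := limit_is_derive t.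
  rewrite limit_derive1 => t; apply/cvg_enormP => e e0.
  have [d /andP[d1 d2] hd] := holder_small e0.
  near=> s; have sd : `|s - t| <= d.
    by rewrite distrC; near: s; exact: cvgr_dist_le.
  apply: le_trans (limit_holder _) _; first exact: le_trans d2.
  by apply: hd; rewrite normr_ge0.
- move=> s t; rewrite !in_itv/= => /andP[s0 s1] /andP[t0 t1] gst.
  have [st|st] := leP `|s - t| 2^-1; first exact: sep.
  (* Parameters more than half a period apart come within half a period when one of them is shifted
     by 1. *)
  have [ts|ts] := leP t s.
    rewrite ger0_norm ?subr_ge0// in st.
    have : s - 1 = t.
      apply: sep; last by rewrite -gp subrK.
      by rewrite ler_norml; apply/andP; split; lra.
    by lra.
  rewrite ltr0_norm ?subr_lt0// in st.
  have : s = t - 1.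
    apply: sep; last by rewrite -(gp (t - 1)) subrK.
    by rewrite ler_norml; apply/andP; split; lra.
  by lra.
- exists L => //; apply: aeW => t; rewrite limit_derive1 fL; exact: lexx.
Unshelve. all: by end_near. Qed.

Lemma limit_speed t : enorm (f t) = L.
Proof.
apply/le_anti/andP; split.
  by apply: (enorm_lim_le PU (@xf t)) => j; rewrite xL.
by apply: (enorm_lim_ge PU (@xf t)) => j; rewrite xL.
Qed.

(* Equicontinuity turns closeness on a finite grid into uniform closeness. *)
Lemma limit_uniform (e : R) : 0 < e ->
  \forall j \near U, forall t, enorm (derive1 (x j) t - f t) <= e.
Proof.
move=> e0; have e30 : 0 < e / 3 by rewrite divr_gt0.
have [d /andP[d1 d2] hd] := holder_small e30.
pose m := Num.bound d^-1.
have m0 : 0 < m%:R :> R.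
  by rewrite (le_lt_trans _ (archi_boundP _)) ?invr_ge0 ?(ltW d1)// ltW.
have md : m%:R^-1 <= d.
  rewrite -[d]invrK lef_pV2 ?posrE ?invr_gt0//.
  by apply/ltW/archi_boundP; rewrite invr_ge0 ltW.
have : \forall j \near U, forall i : 'I_m,
    enorm (derive1 (x j) (i%:R / m%:R) - f (i%:R / m%:R)) <= e / 3.
  apply: filter_forall => i.
  by have /cvg_enormP := @xf (i%:R / m%:R); apply.
apply: filterS => j hj t.
have [z /andP[z0 z1]] := fract_itv t.
have fp s : f (s + 1) = f s.
  have [gp _ _ _] := limit_knot_curve.
  by rewrite -limit_derive1 derive1_periodic.
rewrite -(periodic_int fp t (- z)).
rewrite -(periodic_int (derive1_periodic (xp j)) t (- z)) rmorphN/=.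
move: (t - z%:~R) z0 z1 => {}t t0 t1.
have [i it] : exists i : 'I_m, `|t - i%:R / m%:R| <= d.
  have tm : 0 <= t * m%:R by rewrite mulr_ge0// ltW.
  have /andP[c1 c2] := truncn_itv tm.
  have im : (Num.truncn (t * m%:R)%R < m)%N.
    by rewrite -(ltr_nat R) (le_lt_trans c1)// gtr_pMl.
  exists (Ordinal im) => /=; apply: le_trans md.
  have -> : t - (Num.truncn (t * m%:R))%:R / m%:R =
      (t * m%:R - (Num.truncn (t * m%:R))%:R) / m%:R.
    by rewrite mulrBl mulfK// gt_eqF.
  rewrite normrM ger0_norm ?subr_ge0// gtr0_norm ?invr_gt0//.
  by rewrite ler_piMl ?invr_ge0 ?(ltW m0)//; rewrite -natr1 in c2; lra.
have itd0 := le_trans it d2.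
have itd : 0 <= `|t - i%:R / m%:R| <= d by rewrite normr_ge0.
have h1 := le_trans (xH j itd0) (hd _ itd).
have h2 := hj i.
have h3 := le_trans (limit_holder itd0) (hd _ itd); rewrite enormBC in h3.
apply: le_trans (enormB_trans (derive1 (x j) (i%:R / m%:R)) _ _) _.
have := enormB_trans (f (i%:R / m%:R)) (derive1 (x j) (i%:R / m%:R)) (f t).
by lra.
Qed.

End limits.

(** The ultrafilter contains all tails, so its sets of good indices contain arbitrarily large ones.
    [phi] is not claimed to be increasing; [j <= phi j] is what the energies require. *)
Lemma limit_curve_exists : exists g : R -> 'rV[R]_n, exists phi : nat -> nat,
  [/\ knot_curve g, forall u, enorm (derive1 g u) = L, g 0 = 0,
    forall j, (j <= phi j)%N &
    forall j t, enorm (derive1 (x (phi j)) t - derive1 g t) <= j.+1%:R^-1].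
Proof.
have [U [UU Uoo]] := ultraFilterLemma (eventually_filter).
have PU : ProperFilter U by exact: ultra_proper.
have bx j t : enorm (x j t) <= L * `|t|.
  have := @curve_lipschitz _ _ (x j) (@dx j) L 0 t _.
  by rewrite x0 !subr0; apply => u; rewrite xL.
have exg t : exists a : 'rV[R]_n, x j t @[j --> U] --> a.
  by apply: ultra_bounded_cvg UU _ => j; exact: bx.
have exf t : exists a : 'rV[R]_n, derive1 (x j) t @[j --> U] --> a.
  by apply: (ultra_bounded_cvg (B := L)) UU _ => j; rewrite xL.
have [g xg] := choice exg; have [f xf] := choice exf.
have gf := limit_derive1 UU xg xf.
have close (j : nat) : exists i, (j <= i)%N /\
    forall t, enorm (derive1 (x i) t - derive1 g t) <= j.+1%:R^-1.
  have e0 : 0 < j.+1%:R^-1 :> R by rewrite invr_gt0.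
  have hU := limit_uniform UU xg xf e0.
  have hoo : \forall i \near U, (j <= i)%N by apply: Uoo; exact: nbhs_infty_ge.
  have [i [h1 h2]] := filter_ex (filterI hU hoo).
  by exists i; rewrite gf.
have [phi hphi] := choice close.
exists g, phi; split.
- exact: (limit_knot_curve UU xg xf).
- by move=> u; rewrite gf (limit_speed UU xf).
- apply/eqP; rewrite -enorm_eq0 eq_le enorm_ge0 andbT.
  by apply: (enorm_lim_le PU (@xg 0)) => j; rewrite x0 enorm0.
- by move=> j; have [] := hphi j.
- by move=> j; have [] := hphi j.
Qed.

End limit_curve.

(** * Lower semicontinuity *)

Lemma limn_einf_ge0 (R : realType) (u : nat -> \bar R) :
  (forall j, 0 <= u j)%E -> (0 <= limn_einf u)%E.
Proof.
move=> u0; rewrite limn_einf_lim; apply: lime_ge; first exact: is_cvg_einfs.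
by apply: nearW => j; apply: le_ereal_inf_tmp => _ [k _ <-].
Qed.

Lemma powR_continuous_gt0 (R : realType) (a e : R) : 0 < a ->
  {for a, continuous (fun t : R => t `^ e)}.
Proof.
move=> a0; apply: differentiable_continuous; apply/derivable1_diffP.
by apply: derivable_powR; rewrite in_itv/= a0.
Qed.

Lemma cvg_dotr (R : realType) (n : nat) (T : Type) (F : set_system T)
    (FF : Filter F) (x y : T -> 'rV[R]_n) (a b : 'rV[R]_n) :
  x t @[t --> F] --> a -> y t @[t --> F] --> b ->
  dotr (x t) (y t) @[t --> F] --> dotr a b.
Proof.
move=> xa yb; rewrite /dotr; apply: cvg_big => [|i _]; first exact: add_continuous.
apply: cvgM.
  by apply: (cvg_comp x (fun v : 'rV[R]_n => v ord0 i) xa); exact: coord_continuous.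
by apply: (cvg_comp y (fun v : 'rV[R]_n => v ord0 i) yb); exact: coord_continuous.
Qed.

Lemma cvg_enorm (R : realType) (n : nat) (T : Type) (F : set_system T)
    (FF : Filter F) (x : T -> 'rV[R]_n) (a : 'rV[R]_n) :
  x t @[t --> F] --> a -> enorm (x t) @[t --> F] --> enorm a.
Proof. by move=> xa; apply: (cvg_comp _ _ xa); exact: enorm_continuous. Qed.

Lemma cvg_wedge (R : realType) (n : nat) (T : Type) (F : set_system T)
    (FF : Filter F) (x y : T -> 'rV[R]_n) (a b : 'rV[R]_n) :
  x t @[t --> F] --> a -> y t @[t --> F] --> b ->
  wedge (x t) (y t) @[t --> F] --> wedge a b.
Proof.
move=> xa yb; apply: (cvg_comp (fun t => enorm (x t) ^+ 2 * enorm (y t) ^+ 2 -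
  dotr (x t) (y t) ^+ 2) Num.sqrt); last exact: sqrt_continuous.
have sqr (f : T -> R) (c : R) : f t @[t --> F] --> c -> f t ^+ 2 @[t --> F] --> c ^+ 2.
  by move=> fc; under eq_fun do rewrite expr2; rewrite expr2; exact: cvgM.
apply: cvgB; last by apply: sqr; exact: cvg_dotr.
by apply: cvgM; apply: sqr; exact: cvg_enorm.
Qed.

Lemma le_integral_limn_einf d (T : measurableType d) (R : realType)
    (mu : {measure set T -> \bar R}) (D : set T) (f : nat -> T -> \bar R)
    (g : T -> \bar R) : measurable D ->
  (forall j, measurable_fun setT (f j)) -> (forall j u, 0 <= f j u)%E ->
  measurable_fun setT g -> (forall u, 0 <= g u)%E ->
  (forall u, g u <= limn_einf (f^~ u))%E ->
  (\int[mu]_(u in D) g u <= limn_einf (fun j => \int[mu]_(u in D) f j u))%E.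
Proof.
move=> mD mf f0 mg g0 gf.
have mfD j : measurable_fun D (f j) by exact: measurable_funTS.
apply: le_trans (fatou mu mD mfD (fun j u _ => f0 j u)).
apply: ge0_le_integral => //; first exact: measurable_funTS.
(* Measurability of the lower limit is taken from that of the upper limit of the negatives. *)
have -> : (fun u => limn_einf (f^~ u)) =
    (fun u => - limn_esup (fun j => - f j u))%E.
  by apply/funext => u; rewrite -[RHS]limn_einfN; congr limn_einf;
    apply/funext => j /=; rewrite oppeK.
apply: measurableT_comp => //; apply: measurable_fun_limn_esup => j.
exact: measurableT_comp.
Qed.

Section lower_semicontinuity.
Context {R : realType} {n : nat}.
Variables (p q : R) (x : nat -> R -> 'rV[R]_n) (g : R -> 'rV[R]_n).
Hypotheses (p0 : 0 < p) (q0 : 0 < q).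
Hypotheses (xC1 : forall j, curve_C1 (x j)) (gC1 : curve_C1 g).
Hypothesis xg : forall t, x j t @[j --> \oo] --> g t.
Hypothesis xg' : forall t, derive1 (x j) t @[j --> \oo] --> derive1 g t.

(** Where the wedge or the denominator vanishes for [g], its density is 0 and nonnegativity
    suffices; elsewhere the powers are continuous and the densities converge. *)
Lemma intM_density_lsc (u1 u2 u3 : R) : ((intM_density p q g u1 u2 u3)%:E <=
  limn_einf (fun j => (intM_density p q (x j) u1 u2 u3)%:E))%E.
Proof.
have ge0 : (0 <= limn_einf (fun j => (intM_density p q (x j) u1 u2 u3)%:E))%E.
  by apply: limn_einf_ge0 => j; rewrite lee_fin intM_density_ge0.
have [W0|W0] := eqVneq (wedge (g u2 - g u1) (g u3 - g u1)) 0.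
  by rewrite {1}/intM_density /= W0 powR0 ?gt_eqF// !mul0r.
set D := enorm (g u2 - g u3) * enorm (g u2 - g u1) * enorm (g u3 - g u1).
have [D0|D0] := eqVneq D 0.
  by rewrite {1}/intM_density /= -/D D0 powR0 ?gt_eqF// invr0 mulr0 mul0r.
have Wp : 0 < wedge (g u2 - g u1) (g u3 - g u1) by rewrite lt_def W0 wedge_ge0.
have Dp : 0 < D by rewrite lt_def D0 !mulr_ge0 ?enorm_ge0.
have cB s t : x j s - x j t @[j --> \oo] --> g s - g t by apply: cvgB; exact: xg.
have c : (intM_density p q (x j) u1 u2 u3)%:E @[j --> \oo] -->
    (intM_density p q g u1 u2 u3)%:E.
  apply: cvg_EFin; first exact: nearW.
  rewrite /intM_density /=; apply: cvgM.
    apply: cvgM.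
      apply: (cvg_comp (fun j => wedge (x j u2 - x j u1) (x j u3 - x j u1))
        (fun t : R => t `^ q)).
        by apply: cvg_wedge; exact: cB.
      exact: powR_continuous_gt0.
    apply: cvgV; first by rewrite gt_eqF// powR_gt0.
    apply: (cvg_comp (fun j => enorm (x j u2 - x j u3) * enorm (x j u2 - x j u1) *
      enorm (x j u3 - x j u1)) (fun t : R => t `^ p)).
      by apply: cvgM; [apply: cvgM|]; apply: cvg_enorm; exact: cB.
    exact: powR_continuous_gt0.
  by apply: cvgM; [apply: cvgM|]; apply: cvg_enorm; exact: xg'.
have -> : limn_einf (fun j => (intM_density p q (x j) u1 u2 u3)%:E) =
    (intM_density p q g u1 u2 u3)%:E.
  rewrite is_cvg_limn_einfE; first exact/cvg_lim.
  by apply/cvg_ex; exists (intM_density p q g u1 u2 u3)%:E.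
exact: lexx.
Qed.

Lemma intM_lsc : (intM p q g <= limn_einf (fun j => intM p q (x j)))%E.
Proof.
have mcube : measurable ((`[0%R, 1%R] `*` `[0%R, 1%R]) `*` `[0%R, 1%R] : set (R * R * R)).
  by apply: measurableX; [apply: measurableX|]; exact: measurable_itv.
have mE h : curve_C1 h -> measurable_fun setT
    (fun u : R * R * R => (intM_density p q h u.1.1 u.1.2 u.2)%:E).
  by move=> hC1; apply/measurable_EFinP; exact: measurable_intM_density.
apply: (@le_integral_limn_einf _ _ R
  ((@lebesgue_measure R) \x (@lebesgue_measure R) \x (@lebesgue_measure R))%E _
  (fun j u => (intM_density p q (x j) u.1.1 u.1.2 u.2)%:E)
  (fun u => (intM_density p q g u.1.1 u.1.2 u.2)%:E) mcube).
- by move=> j; exact: mE.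
- by move=> j u; rewrite lee_fin intM_density_ge0.
- exact: mE.
- by move=> u; rewrite lee_fin intM_density_ge0.
- by move=> u; exact: intM_density_lsc.
Qed.

End lower_semicontinuity.

(** * Minimization *)

Section knot_normalization.
Context {R : realType} {n : nat}.
Implicit Types g h : R -> 'rV[R]_n.

Lemma is_derive_affine_curve g (c t : R) (v : 'rV[R]_n) : derivable g t 1 ->
  is_derive t 1 (fun u => c *: g u + v) (c *: derive1 g t).
Proof.
move=> dg; apply: is_derive_row => i.
have di := is_derive_coord i dg.
have -> : (fun u => (c *: g u + v) ord0 i) = (fun u => c * g u ord0 i + v ord0 i).
  by apply/funext => u; rewrite !mxE.
by apply: is_derive_eq; rewrite addr0 mxE.
Qed.

Lemma derive1_affine_curve g (c : R) (v : 'rV[R]_n) : (forall t : R, derivable g t 1) ->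
  derive1 (fun u => c *: g u + v) = (fun t => c *: derive1 g t).
Proof.
move=> dg; apply/funext => t; rewrite derive1E.
by have [_ ->] := is_derive_affine_curve c v (dg t).
Qed.

Lemma knot_curve_affine g (c : R) (v : 'rV[R]_n) : 0 < c -> knot_curve g ->
  knot_curve (fun u => c *: g u + v).
Proof.
move=> c0 [gp [dg cg] ginj [k k0 greg]]; have d := derive1_affine_curve c v dg.
split.
- by move=> t; rewrite gp.
- split; first by move=> t; have [] := is_derive_affine_curve c v (dg t).
  rewrite d => t; apply: cvgZ; [exact: cvg_cst|exact: cg].
- move=> s t sin tin /addIr /(scalerI (lt0r_neq0 c0)); exact: ginj.
- exists (c * k); first exact: mulr_gt0.
  apply: aeW => t; rewrite d enormZ gtr0_norm// ler_pM2l//.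
  exact: (ae_ge_continuous (continuous_speed cg) greg).
Qed.

Lemma curve_length_const_speed g (l : R) : (forall u, enorm (derive1 g u) = l) ->
  curve_length g = l%:E.
Proof.
move=> gl; rewrite /curve_length.
under eq_integral do rewrite gl.
have l1 : lebesgue_measure (`[0%R, 1%R]%classic : set R) = 1%E.
  by rewrite lebesgue_measure_itv/= lte_fin ltr01 sube0.
by rewrite integral_cst//; exact: (etrans (congr1 (mule l%:E) l1) (mule1 _)).
Qed.

(** Serves the case of an infinite infimum, where any curve of the class with the right length is a
    minimizer. *)
Lemma exists_knot_of_length g0 (L : R) : knot_curve g0 -> 0 < L ->
  exists h, [/\ knot_curve h, ambient_isotopic g0 h & curve_length h = L%:E].
Proof.
move=> kg0 L0; have [l [h [l0 kh rh hl _]]] := constant_speed_reparametrization kg0.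
have c0 : 0 < L / l by rewrite divr_gt0.
have e : (fun u => (L / l) *: h u + 0) = (fun u => (L / l) *: h u).
  by apply/funext => u; rewrite addr0.
exists (fun u => (L / l) *: h u); split.
- by rewrite -e; exact: knot_curve_affine.
- apply: ambient_isotopic_dilation c0.
  exact: ambient_isotopic_range (ambient_isotopic_refl g0) (esym rh).
- have [_ [dh _] _ _] := kh.
  apply: curve_length_const_speed => u; rewrite -e.
  by rewrite derive1_affine_curve// enormZ gtr0_norm// hl divfK// gt_eqF.
Qed.

(** Reparametrization keeps the range and the energy, and translation to the origin keeps the class
    and the energy. *)
Lemma knot_normal_form g0 g (L : R) : knot_curve g -> ambient_isotopic g0 g ->
  curve_length g = L%:E ->
  exists h, [/\ knot_curve h, ambient_isotopic g0 h,
    forall u, enorm (derive1 h u) = L, h 0 = 0 &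
    forall p q, intM p q h = intM p q g].
Proof.
move=> kg g0g; have [l [h [l0 kh rh hl [-> hM]]]] := constant_speed_reparametrization kg.
move=> [lL]; have [_ [dh _] _ _] := kh.
pose f := fun u => 1 *: h u + (- h 0).
have fE u : f u = h u - h 0 by rewrite /f scale1r.
have df : derive1 f = derive1 h.
  by rewrite /f derive1_affine_curve//; apply/funext => u; rewrite scale1r.
exists f; split.
- exact: knot_curve_affine.
(* The displacement of a translation is constant, hence [k = 0]. *)
- apply: (ambient_isotopic_perturbation (g := h) (k := 0)).
  + exact: ambient_isotopic_range g0g (esym rh).
  + by rewrite lexx ltr01.
  + have fh u : f u - h u = - h 0 by rewrite fE addrAC subrr sub0r.
    by move=> u v; rewrite !fh subrr normr0 mul0r.
- by move=> u; rewrite df hl.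
- by rewrite fE subrr.
- move=> p q; rewrite -hM /intM; apply: eq_integral => -[[u1 u2] u3] _ /=.
  have fB s t : f s - f t = h s - h t.
    by rewrite !fE opprB addrA subrK.
  by rewrite /intM_density /= !fB df.
Qed.

Lemma curve_sub_lipschitz g h (e s t : R) : (forall u : R, derivable g u 1) ->
  (forall u : R, derivable h u 1) ->
  (forall u, enorm (derive1 g u - derive1 h u) <= e) ->
  enorm ((g t - h t) - (g s - h s)) <= e * `|t - s|.
Proof.
move=> dg dh gh.
have dD (u : R) : is_derive u 1 (g - h) (derive1 g u - derive1 h u).
  have h1 : is_derive u 1 g (derive1 g u) by split; [exact: dg|rewrite derive1E].
  have h2 : is_derive u 1 h (derive1 h u) by split; [exact: dh|rewrite derive1E].
  exact: is_deriveB.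
apply: (@curve_lipschitz _ _ (g - h)) => [u|u]; first by have [] := dD u.
by rewrite derive1E; have [_ ->] := dD u.
Qed.

(** The displacement is [e]-Lipschitz in the parameter and [x] expands by [b] up to half a period,
    so the displacement is Lipschitz along [x] with constant [n * e / b <= 1/2]; the factor [n]
    converts the Euclidean norm into the sup norm. *)
Lemma ambient_isotopic_close g0 x g (b e : R) : ambient_isotopic g0 x ->
  closed_curve x -> closed_curve g -> (forall t : R, derivable x t 1) ->
  (forall t : R, derivable g t 1) -> 0 < b -> 0 <= e -> 2 * n%:R * e <= b ->
  (forall s t, `|s - t| <= 2^-1 -> b * `|s - t| <= enorm (x s - x t)) ->
  (forall t, enorm (derive1 x t - derive1 g t) <= e) ->
  ambient_isotopic g0 g.
Proof.
move=> g0x xp gp dx dg b0 e0 eb xb xg.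
apply: (ambient_isotopic_perturbation (k := 2^-1)) g0x _ _.
  by rewrite invr_ge0 ler0n/= invf_lt1// ltr1n.
pose D u := g u - x u.
have lipD s t : enorm (D t - D s) <= e * `|t - s|.
  by apply: (curve_sub_lipschitz s t dg dx) => u; rewrite enormBC.
move=> u v; have [z /andP[z0 z1]] := fract_itv (u - v + 2^-1).
(* An integer shift brings [v] within half a period of [u] without changing the points. *)
pose v' := v + z%:~R.
have uv : `|u - v'| <= 2^-1 by rewrite ler_norml /v'; apply/andP; split; lra.
have xv : x v = x v' by rewrite /v' (periodic_int xp).
have gv : g v = g v' by rewrite /v' (periodic_int gp).
rewrite xv gv -[_ - _ - _]/(D u - D v').
apply: le_trans (normr_le_enorm _) _; apply: le_trans (lipD _ _) _.
have h1 := le_trans (xb _ _ uv) (enorm_le_normr (x u - x v')).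
have h2 := ler_wpM2l e0 h1.
have h3 := ler_wpM2r (normr_ge0 (x u - x v')) eb.
rewrite -(ler_pM2l b0).
move: h2 h3; move: `|x u - x v'| `|u - v'| => X Y h2 h3.
lra.
Qed.

End knot_normalization.

(** * Limits of curves of bounded energy *)

Section minimizing_sequence.
Context {R : realType} {n : nat}.
Variables (p q L M : R) (x : nat -> R -> 'rV[R]_n).
Hypotheses (p0 : 0 < p) (q1 : 1 < q) (pq : 2 / 3 * q + 1 < p) (L0 : 0 < L) (M0 : 0 < M).
Hypothesis kx : forall j, knot_curve (x j).
Hypothesis xL : forall j u, enorm (derive1 (x j) u) = L.
Hypothesis x0 : forall j, x j 0 = 0.
Hypothesis xM : forall j, (intM p q (x j) <= M%:E)%E.

(** All constants come from [p], [q], [M] and [L], hence are common to the sequence; [b] is returned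
    because it decides how close in [C^1] a curve must be to be isotopic. *)
Lemma bounded_energy_limit : exists2 b : R, 0 < b &
  (forall j s t, `|s - t| <= 2^-1 -> b * `|s - t| <= enorm (x j s - x j t)) /\
  exists g : R -> 'rV[R]_n, exists phi : nat -> nat,
  [/\ knot_curve g, forall u, enorm (derive1 g u) = L,
    forall j, (j <= phi j)%N,
    forall j t, enorm (derive1 (x (phi j)) t - derive1 g t) <= j.+1%:R^-1 &
    (intM p q g <= limn_einf (fun j => intM p q (x (phi j))))%E].
Proof.
have q0 : 0 < q by exact: lt_trans q1.
have e2 := flat_exponent_gt2 q1 pq.
have C0 := flat_const_gt0 p q M0.
have xp j : closed_curve (x j) by have [] := kx j.
have xC1 j : curve_C1 (x j) by have [] := kx j.
have xinj j : curve_injective (x j) by have [] := kx j.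
have dx j (t : R) : derivable (x j) t 1 by have [] := xC1 j.
have fl j := energy_flat p0 q0 M0 L0 (xp j) (xC1 j) (xL j) (xM j).
have b0 := bilipschitz_const_gt0 C0 e2 L0.
have d0 := bootstrap_scale_gt0 C0 e2 L0.
have H0 : 0 < 2 * L * holder_const (flat_const p q M) (flat_exponent p q).
  by rewrite mulr_gt0 ?holder_const_gt0// mulr_gt0.
have k0 : 0 < flat_exponent p q - 2 by rewrite subr_gt0.
have xH j s t := @flat_holder _ _ _ _ _ _ C0 e2 L0 (xp j) (xC1 j) (xL j) (fl j) s t.
have xb j s t := @flat_bilipschitz _ _ _ _ _ _ C0 e2 L0 (xp j) (xC1 j) (xL j) (fl j) (xinj j) s t.
exists (bilipschitz_const (flat_const p q M) (flat_exponent p q) L); first exact: b0.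
split; first exact: xb.
have [g [phi [kg gL g0 hphi hx]]] := limit_curve_exists L0 b0 d0 H0 k0 xp dx xL x0 xH xb.
have [_ gC1 _ _] := kg.
have inv (e : R) : 0 < e -> \forall j \near \oo, j.+1%:R^-1 <= e.
  move=> e0; near=> j; apply: ltW; near: j.
  exact: (near_infty_natSinv_lt (PosNum e0)).
exists g, phi; split; [exact: kg|exact: gL|exact: hphi|exact: hx|].
apply: (intM_lsc p0 q0 (fun j => xC1 (phi j)) gC1).
- move=> t; apply/cvg_enormP => e e0.
  have t1 : 0 < `|t| + 1 by rewrite ltr_wpDl.
  near=> j.
  (* Both curves start at 0, so the derivative bound gives an error of at most [|t| / (j + 1)]. *)
  have := curve_sub_lipschitz 0 t (dx (phi j)) gC1.1 (hx j).
  rewrite x0 g0 !subr0 => /le_trans; apply.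
  apply: (@le_trans _ _ (j.+1%:R^-1 * (`|t| + 1))).
    by rewrite ler_wpM2l ?invr_ge0// lerDl.
  rewrite -ler_pdivlMr//; near: j; apply: inv.
  by rewrite divr_gt0.
- move=> t; apply/cvg_enormP => e e0; near=> j.
  apply: le_trans (hx j t) _; near: j; exact: inv.
Unshelve. all: by end_near. Qed.

End minimizing_sequence.

Lemma intM_ge0 (R : realType) (n : nat) (p q : R) (g : R -> 'rV[R]_n) :
  (0 <= intM p q g)%E.
Proof. by apply: integral_ge0 => u _; rewrite lee_fin intM_density_ge0. Qed.

Unset Implicit Arguments.

Theorem theorem2 (R : realType) (n : nat) (p q : R) (hq : 1 < q)
    (hp : 2 / 3 * q + 1 < p < q + 2 / 3)
    (K : set (R -> 'rV[R]_n)) (hK : knot_class K) (L : R) (hL : 0 < L) :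
  exists g : R -> 'rV[R]_n, minimizer (intM p q) (K `&` of_length L) g.
Proof.
have [g0 kg0 KE] := hK; have /andP[pq _] := hp.
have p0 : 0 < p by lra.
pose A := K `&` of_length L.
pose m := ereal_inf (intM p q @` A).
have mle y : A y -> (m <= intM p q y)%E by move=> Ay; apply: ereal_inf_lbound; exists y.
(* With an infinite infimum every competitor has infinite energy, and it remains to exhibit one. *)
have [moo|moo] := eqVneq m +oo%E.
  have [h [kh g0h hL']] := exists_knot_of_length kg0 hL.
  exists h; split.
    by split; [rewrite KE; split; [exact: kh|exact: g0h]|exact: hL'].
  move=> y Ay; apply: (@le_trans _ _ +oo%E); first exact: leey.
  by rewrite -moo; exact: mle.
have m0 : (0 <= m)%E by apply: le_ereal_inf_tmp => _ [y _ <-]; exact: intM_ge0.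
have mfin : m \is a fin_num by rewrite ge0_fin_numE// ltey.
have seq_ex (j : nat) : exists x : R -> 'rV[R]_n,
    [/\ knot_curve x, ambient_isotopic g0 x, forall u, enorm (derive1 x u) = L,
      x 0 = 0 & (intM p q x < m + (j.+1%:R^-1)%:E)%E].
  have e0 : 0 < j.+1%:R^-1 :> R by rewrite invr_gt0.
  have [_ [y [Ky yL] <-] ym] := lb_ereal_inf_adherent e0 mfin.
  move: Ky; rewrite KE => -[ky g0y].
  have [x [kx g0x xL x0 xE]] := knot_normal_form ky g0y yL.
  by exists x; split; [exact: kx|exact: g0x|exact: xL|exact: x0|rewrite xE].
have [x hx] := choice seq_ex.
have kx j : knot_curve (x j) by have [] := hx j.
have g0x j : ambient_isotopic g0 (x j) by have [] := hx j.
have xL j : forall u, enorm (derive1 (x j) u) = L by have [] := hx j.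
have x0 j : x j 0 = 0 by have [] := hx j.
have xm j : (intM p q (x j) < m + (j.+1%:R^-1)%:E)%E by have [] := hx j.
have M0 : 0 < fine m + 1 by rewrite ltr_wpDl// fine_ge0.
(* As [1 / (j + 1) <= 1], the bound [m + 1] is uniform along the sequence. *)
have xM j : (intM p q (x j) <= (fine m + 1)%:E)%E.
  apply: le_trans (ltW (xm j)) _; rewrite EFinD fineK// leeD2l// lee_fin.
  by rewrite invf_le1// ler1n.
have [b b0 [xb [g [phi [kg gL hphi hxg gE]]]]] :=
  bounded_energy_limit p0 hq pq hL M0 kx xL x0 xM.
have Ax j : A (x j).
  split; last exact: curve_length_const_speed (xL j).
  by rewrite KE; split; [exact: kx|exact: g0x].
(* Since [j <= phi j], the energies lie between [m] and [m + 1 / (j + 1)]. *)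
have Em : intM p q (x (phi j)) @[j --> \oo] --> m.
  have cm : m + (j.+1%:R^-1)%:E @[j --> \oo] --> m.
    rewrite -[X in _ --> X]adde0; apply: cvgeD; last 2 first.
    - exact: cvg_cst.
    - apply: cvg_EFin; first exact: nearW.
      exact: cvg_harmonic.
    - by rewrite fin_num_adde_defl.
  apply: (squeeze_cvge (f := fun=> m) _ (cvg_cst m) cm).
  apply: nearW => j; apply/andP; split; first exact: mle.
  apply: le_trans (ltW (xm _)) _.
  by rewrite leeD2l// lee_fin lef_pV2 ?posrE// ler_nat ltnS.
exists g; split.
  split; last exact: curve_length_const_speed gL.
  rewrite KE; split; first exact: kg.
  (* A single curve of the sequence, close enough to [g] in [C^1], already puts [g] in the knot
     class. *)
  have [j hj] : exists j : nat, 2 * n%:R * j.+1%:R^-1 <= b.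
    have r0 : 0 <= b^-1 * (2 * n%:R) by rewrite mulr_ge0 ?invr_ge0 ?(ltW b0)// mulr_ge0.
    exists (Num.bound (b^-1 * (2 * n%:R))).
    rewrite ler_pdivrMr// -ler_pdivrMl// ltW//.
    by rewrite (lt_le_trans (archi_boundP r0))// ler_nat.
  have [xp [dx _] _ _] := kx (phi j); have [gp [dg _] _ _] := kg.
  apply: (ambient_isotopic_close (g0x (phi j)) xp gp dx dg b0 _ hj (xb _) (hxg j)).
  by rewrite invr_ge0.
move=> y Ay; apply: le_trans gE _; rewrite is_cvg_limn_einfE.
  by rewrite (cvg_lim _ Em)//; exact: mle.
by apply/cvg_ex; exists m.
Qed.
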